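(* There is a computable coloring $c:\mathcal{P}_{fin}(\mathbb{N})\rightarrow\{0,1\}$ such that for every finite $\mathcal{B}\subseteq\mathcal{P}_{fin}(\mathbb{N})$ and every computably enumerable $\mathcal{S}\subseteq\mathcal{P}_{fin}(\mathbb{N})$ containing infinitely many pairwise disjoint elements, $\mathcal{B}$ does not full-match $NU(\mathcal{S})$; that is, there is $T\in NU(\mathcal{S})$ such that there is no $B\in\mathcal{B}$ with $\max B<\min T$ and $c(B)=c(T)=c(B\cup T)$.
   Context: $\mathcal{P}_{fin}(\mathbb{N})$ is the set of finite subsets of $\mathbb{N}$, identified with $\mathbb{N}$ via a fixed computable bijection; computability and computable enumerability are with respect to this identification. For $\mathcal{S}\subseteq\mathcal{P}_{fin}(\mathbb{N})$, $NU(\mathcal{S})$ denotes the set of non-empty sets which are unions of finitely many elements of $\mathcal{S}$. Convention in this setting: a union $B\cup T$ of two finite sets is only considered when $\max B<\min T$. Relative to $c$: a family $\mathcal{B}$ full-matches a set $T$ if there is $B\in\mathcal{B}$ with $\max B<\min T$ and $c(B)=c(T)=c(B\cup T)$, and full-matches a family if it full-matches each member. *)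

(* Defs.v *)
From Stdlib Require Import Arith List.
Import ListNotations.

Inductive PR : Type :=
| PRzero : PR
| PRsucc : PR
| PRproj : nat -> PR
| PRcomp : PR -> list PR -> PR
| PRprec : PR -> PR -> PR
| PRmu   : PR -> PR.

Inductive evalPR : PR -> list nat -> nat -> Prop :=
| ev_zero v : evalPR PRzero v 0
| ev_succ v : evalPR PRsucc v (S (hd 0 v))
| ev_proj i v : evalPR (PRproj i) v (nth i v 0)
| ev_comp f gs v ws y :
    Forall2 (fun g w => evalPR g v w) gs ws ->
    evalPR f ws y -> evalPR (PRcomp f gs) v y
| ev_prec0 f g v y : evalPR f v y -> evalPR (PRprec f g) (0 :: v) y
| ev_precS f g x v r y :
    evalPR (PRprec f g) (x :: v) r ->
    evalPR g (x :: r :: v) y -> evalPR (PRprec f g) (S x :: v) y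
| ev_mu f v n :
    evalPR f (n :: v) 0 ->
    (forall m, m < n -> exists k, evalPR f (m :: v) (S k)) ->
    evalPR (PRmu f) v n.

Definition computable_bool (c : nat -> bool) : Prop :=
  exists p : PR, forall n, evalPR p [n] (if c n then 1 else 0).

Definition c_e (A : nat -> Prop) : Prop :=
  exists p : PR, forall n, A n <-> exists y, evalPR p [n] y.

(* ---------- Finite subsets of N coded by naturals ----------
   The fixed computable bijection P_fin(N) ~ N: the code n represents
   the finite set { i | bit i of n is 1 }. *)
Definition fmem (n i : nat) : bool := Nat.testbit n i.

Definition funion (a b : nat) : nat := Nat.lor a b.
Definition fdisjoint (a b : nat) : Prop := Nat.land a b = 0.

(* max B < min T (both sets non-empty, so that max and min exist) *)
Definition before (B T : nat) : Prop :=
  B <> 0 /\ T <> 0 /\ forall i j, fmem B i = true -> fmem T j = true -> i < j.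

Definition NUset (S : nat -> Prop) (T : nat) : Prop :=
  T <> 0 /\ exists l : list nat, (forall x, In x l -> S x) /\ T = fold_right funion 0 l.

Definition inf_pairwise_disjoint (S : nat -> Prop) : Prop :=
  exists f : nat -> nat,
    (forall n, S (f n)) /\
    (forall m n, m <> n -> f m <> f n) /\
    (forall m n, m <> n -> fdisjoint (f m) (f n)).

Definition full_matches (c : nat -> bool) (Bs : list nat) (T : nat) : Prop :=
  exists B, In B Bs /\ before B T /\ c B = c T /\ c T = c (funion B T).

Definition full_matches_family (c : nat -> bool) (Bs : list nat) (F : nat -> Prop) : Prop :=
  forall T, F T -> full_matches c Bs T.

(* Main.v *)
(** Requirement [e] asks that the [e]-th c.e. family [S] escape every finite family of sets
    below [e].  A finite injury construction gives it an interval of numbers and eight sets built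
    from [S] inside that interval, its tokens: a root [U], and for each target [b < 7] the union
    [T_b] of [U] and some later [Z_b] in [S].  The records in force at stage [s] form a
    stack ordered by priority.  In a set [X], the element [x] triggers an event, a number in
    {1, 2, 4} (or 0 for a root), when the part of [X] below [x] ends with a token in force at
    stage [x]; and [X] gets color 0 iff the sum of the events triggered after the last [x] at which
    that part was a token equals the target of this token modulo 7.

    Let [Z] in [S] lie beyond the interval, let [b] be its event sum modulo 7 and [T] the union of
    [T_b] and [Z].  Then [T] has color 0.  If [B] below the interval has color 0, then going from
    [B] to its union with [T] adds to the sum the event [v] pending at the end of [B], which is in
    {0, 1, 2, 4}, and the total over [T].  The event of [T_b] is chosen so that this total is in
    {1, 2, 4} modulo 7; as {1, 2, 4} + {0, 1, 2, 4} avoids 0, the union has color 1.  The only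
    obstruction is a [B] of color 0 that is itself a token, for then the sum is restarted: roots
    have the unreachable target 7, so that every set starting with a root has color 1 until its
    next token, and in particular so have all tokens [T_b]. *)
Require Import Defs.
From Stdlib Require Import Arith List.
From Stdlib Require Import Lia Bool Sorted Classical.
Import ListNotations.

(** * Programs for elementary functions and pairing *)

Definition computable1 (F : nat -> nat) : Prop := exists p, forall n, evalPR p [n] (F n).
Definition computable2 (F : nat -> nat -> nat) : Prop :=
  exists p, forall x y, evalPR p [x; y] (F x y).

Lemma ev_proj_eq i v y : nth i v 0 = y -> evalPR (PRproj i) v y.
Proof. intros <-; constructor. Qed.

Lemma ev_succ_eq v y : S (hd 0 v) = y -> evalPR PRsucc v y.
Proof. intros <-; constructor. Qed.

Lemma ev_comp1 f g v w y :
  evalPR g v w -> evalPR f [w] y -> evalPR (PRcomp f [g]) v y.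
Proof. intros; eapply ev_comp; eauto. Qed.

Lemma ev_comp2 f g1 g2 v w1 w2 y :
  evalPR g1 v w1 -> evalPR g2 v w2 -> evalPR f [w1; w2] y ->
  evalPR (PRcomp f [g1; g2]) v y.
Proof. intros; eapply ev_comp; eauto. Qed.

Lemma ev_prec_rect f g v a G :
  evalPR f v a ->
  (forall k r, evalPR g (k :: r :: v) (G k r)) ->
  forall n, evalPR (PRprec f g) (n :: v) (nat_rect (fun _ => nat) a G n).
Proof.
  intros Hf Hg n; induction n; simpl.
  - now constructor.
  - econstructor; eauto.
Qed.

Lemma computable1_id : computable1 (fun n => n).
Proof. exists (PRproj 0); intros; now apply ev_proj_eq. Qed.

Lemma computable1_S : computable1 S.
Proof. exists PRsucc; intros; now apply ev_succ_eq. Qed.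

Lemma computable1_comp F G : computable1 F -> computable1 G -> computable1 (fun n => F (G n)).
Proof.
  intros [p Hp] [q Hq]; exists (PRcomp p [q]); intros n.
  eapply ev_comp1; eauto.
Qed.

Lemma computable1_const k : computable1 (fun _ => k).
Proof.
  induction k.
  - exists PRzero; intros; constructor.
  - exact (computable1_comp _ _ computable1_S IHk).
Qed.

Lemma computable1_comp2 F G1 G2 :
  computable2 F -> computable1 G1 -> computable1 G2 -> computable1 (fun n => F (G1 n) (G2 n)).
Proof.
  intros [p Hp] [q1 H1] [q2 H2]; exists (PRcomp p [q1; q2]); intros n.
  eapply ev_comp2; eauto.
Qed.

Lemma computable2_comp1 F G : computable1 F -> computable2 G -> computable2 (fun x y => F (G x y)).
Proof.
  intros [p Hp] [q Hq]; exists (PRcomp p [q]); intros x y.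
  eapply ev_comp1; eauto.
Qed.

Lemma computable2_comp2 F G1 G2 :
  computable2 F -> computable2 G1 -> computable2 G2 -> computable2 (fun x y => F (G1 x y) (G2 x y)).
Proof.
  intros [p Hp] [q1 H1] [q2 H2]; exists (PRcomp p [q1; q2]); intros x y.
  eapply ev_comp2; eauto.
Qed.

Lemma computable2_l F : computable1 F -> computable2 (fun x _ => F x).
Proof.
  intros [p Hp]; exists (PRcomp p [PRproj 0]); intros x y.
  eapply ev_comp1; eauto; now apply ev_proj_eq.
Qed.

Lemma computable2_r F : computable1 F -> computable2 (fun _ y => F y).
Proof.
  intros [p Hp]; exists (PRcomp p [PRproj 1]); intros x y.
  eapply ev_comp1; eauto; now apply ev_proj_eq.
Qed.

Lemma computable2_ext F G : (forall x y, F x y = G x y) -> computable2 F -> computable2 G.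
Proof. intros E [p Hp]; exists p; intros; rewrite <- E; auto. Qed.

Lemma computable1_ext F G : (forall x, F x = G x) -> computable1 F -> computable1 G.
Proof. intros E [p Hp]; exists p; intros; rewrite <- E; auto. Qed.

Lemma computable1_prec a G : computable2 G -> computable1 (nat_rect (fun _ => nat) a G).
Proof.
  intros [q Hq]; destruct (computable1_const a) as [p Hp].
  exists (PRcomp (PRprec p (PRcomp q [PRproj 0; PRproj 1])) [PRproj 0; PRproj 0]).
  intros n; eapply ev_comp2; try (now apply ev_proj_eq).
  apply ev_prec_rect; [apply Hp|]; intros.
  eapply ev_comp2; try (now apply ev_proj_eq); apply Hq.
Qed.

Lemma computable2_prec F G :
  computable1 F -> computable2 G ->
  computable2 (fun n x => nat_rect (fun _ => nat) (F x) (fun k r => G r x) n).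
Proof.
  intros [p Hp] [q Hq].
  exists (PRprec p (PRcomp q [PRproj 1; PRproj 2])).
  intros n x; apply (ev_prec_rect _ _ [x] (F x) (fun k r => G r x)); [apply Hp|]; intros.
  eapply ev_comp2; try (now apply ev_proj_eq); apply Hq.
Qed.

Lemma computable2_add : computable2 Nat.add.
Proof.
  eapply computable2_ext;
    [|apply (computable2_prec (fun x => x) (fun r _ => S r) computable1_id
               (computable2_l S computable1_S))].
  intros x y; simpl; induction x; simpl; congruence.
Qed.

Lemma computable1_pred : computable1 Nat.pred.
Proof.
  eapply computable1_ext;
    [|apply (computable1_prec 0 (fun k _ => k) (computable2_l _ computable1_id))].
  now intros [|x].
Qed.

Lemma computable2_sub : computable2 Nat.sub.
Proof.
  apply computable2_ext with
    (F := fun x y => (fun n x => nat_rect (fun _ => nat) x (fun k r => Nat.pred r) n) y x).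
  - intros x y; simpl; induction y; simpl; lia.
  - apply (computable2_comp2 (fun n x => nat_rect (fun _ => nat) x (fun k r => Nat.pred r) n)
             (fun _ y => y) (fun x _ => x)).
    + exact (computable2_prec (fun x => x) (fun r _ => Nat.pred r) computable1_id
               (computable2_l _ computable1_pred)).
    + exact (computable2_r _ computable1_id).
    + exact (computable2_l _ computable1_id).
Qed.

Definition tri : nat -> nat := nat_rect (fun _ => nat) 0 (fun k r => S k + r).
Definition npair (x y : nat) : nat := y + tri (x + y).
(** The largest [d] with [tri d <= n]. Truncated subtraction is the test: the increment is 1 exactly
    when [tri (S d) <= S k]. *)
Definition diag : nat -> nat :=
  nat_rect (fun _ => nat) 0 (fun k d => d + (1 - (tri (S d) - S k))).
Definition sndn (n : nat) : nat := n - tri (diag n).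
Definition fstn (n : nat) : nat := diag n - sndn n.

Lemma computable1_tri : computable1 tri.
Proof.
  apply computable1_prec, (computable2_comp2 Nat.add (fun k _ => S k) (fun _ r => r)).
  - exact computable2_add.
  - exact (computable2_l _ computable1_S).
  - exact (computable2_r _ computable1_id).
Qed.

Lemma computable2_npair : computable2 npair.
Proof.
  apply (computable2_comp2 Nat.add (fun _ y => y) (fun x y => tri (x + y))).
  - exact computable2_add.
  - exact (computable2_r _ computable1_id).
  - exact (computable2_comp1 _ _ computable1_tri computable2_add).
Qed.

Lemma computable1_diag : computable1 diag.
Proof.
  apply computable1_prec.
  apply (computable2_comp2 Nat.add (fun _ d => d) (fun k d => 1 - (tri (S d) - S k))
           computable2_add).
  - exact (computable2_r _ computable1_id).
  - apply (computable2_comp2 Nat.sub (fun _ _ => 1) (fun k d => tri (S d) - S k) computable2_sub).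
    + exact (computable2_l _ (computable1_const 1)).
    + apply (computable2_comp2 Nat.sub (fun _ d => tri (S d)) (fun k _ => S k) computable2_sub).
      * exact (computable2_r _ (computable1_comp _ _ computable1_tri computable1_S)).
      * exact (computable2_l _ computable1_S).
Qed.

Lemma computable1_snd : computable1 sndn.
Proof.
  exact (computable1_comp2 Nat.sub _ _ computable2_sub computable1_id
           (computable1_comp _ _ computable1_tri computable1_diag)).
Qed.

Lemma computable1_fst : computable1 fstn.
Proof. exact (computable1_comp2 Nat.sub _ _ computable2_sub computable1_diag computable1_snd). Qed.

Lemma tri_S n : tri (S n) = S n + tri n.
Proof. reflexivity. Qed.

Lemma tri_mono m n : m <= n -> tri m <= tri n.
Proof. induction 1; [lia|]; rewrite tri_S; lia. Qed.

Lemma diag_spec n : tri (diag n) <= n < tri (S (diag n)).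
Proof.
  induction n; [cbv; lia|].
  change (diag (S n)) with (diag n + (1 - (tri (S (diag n)) - S n))).
  destruct (Nat.leb_spec (tri (S (diag n))) (S n)).
  - replace (1 - (tri (S (diag n)) - S n)) with 1 by lia.
    rewrite Nat.add_1_r, (tri_S (S (diag n))); lia.
  - replace (1 - (tri (S (diag n)) - S n)) with 0 by lia.
    rewrite Nat.add_0_r; lia.
Qed.

Lemma diag_npair x y : diag (npair x y) = x + y.
Proof.
  pose proof (diag_spec (npair x y)) as H.
  assert (E : tri (x + y) <= npair x y < tri (S (x + y))).
  { unfold npair; rewrite tri_S; lia. }
  destruct (Nat.lt_trichotomy (diag (npair x y)) (x + y)) as [L | [L | L]]; auto.
  - pose proof (tri_mono (S (diag (npair x y))) (x + y)); lia.
  - pose proof (tri_mono (S (x + y)) (diag (npair x y))); lia.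
Qed.

Lemma sndn_npair x y : sndn (npair x y) = y.
Proof. unfold sndn; rewrite diag_npair; unfold npair; lia. Qed.

Lemma fstn_npair x y : fstn (npair x y) = x.
Proof. unfold fstn; rewrite sndn_npair, diag_npair; lia. Qed.

Lemma npair_surj n : npair (fstn n) (sndn n) = n.
Proof.
  pose proof (diag_spec n) as H; rewrite tri_S in H.
  unfold npair, fstn, sndn; replace (diag n - _ + _) with (diag n) by lia; lia.
Qed.

Lemma npair_ge_r x y : y <= npair x y.
Proof. unfold npair; lia. Qed.

Lemma computable1_npair F G :
  computable1 F -> computable1 G -> computable1 (fun n => npair (F n) (G n)).
Proof. exact (computable1_comp2 npair F G computable2_npair). Qed.

(** The step receives parameter, counter and previous value packed as [Enc_prod] codes a triple, the
    form in which [cmp_nat_rect] uses it. *)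
Lemma computable1_rec F G N :
  computable1 F -> computable1 G -> computable1 N ->
  computable1 (fun n => nat_rect (fun _ => nat) (F n) (fun k a => G (npair n (npair k a))) (N n)).
Proof.
  intros [p Hp] [q Hq] [r Hr]; destruct computable2_npair as [c Hc].
  exists (PRcomp (PRprec p (PRcomp q [PRcomp c [PRproj 2; PRcomp c [PRproj 0; PRproj 1]]]))
            [r; PRproj 0]).
  intros n; eapply ev_comp2; [apply Hr | now apply ev_proj_eq |].
  apply (ev_prec_rect _ _ [n] (F n) (fun k a => G (npair n (npair k a)))); [apply Hp|]; intros.
  eapply ev_comp1; [|apply Hq].
  eapply ev_comp2; [now apply ev_proj_eq | | apply Hc].
  eapply ev_comp2; try (now apply ev_proj_eq); apply Hc.
Qed.

(** * Computability on encoded types *)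

Class Enc (A : Type) := { enc : A -> nat; enc_inj : forall a b, enc a = enc b -> a = b }.

#[global] Instance Enc_nat : Enc nat := {| enc := fun n => n; enc_inj := fun a b E => E |}.

Lemma enc_bool_inj (a b : bool) : (if a then 1 else 0) = (if b then 1 else 0) -> a = b.
Proof. destruct a, b; congruence. Qed.
#[global] Instance Enc_bool : Enc bool :=
  {| enc := fun b : bool => if b then 1 else 0; enc_inj := enc_bool_inj |}.

Lemma npair_inj a b c d : npair a b = npair c d -> a = c /\ b = d.
Proof.
  intros E; split.
  - now rewrite <- (fstn_npair a b), E, fstn_npair.
  - now rewrite <- (sndn_npair a b), E, sndn_npair.
Qed.

Lemma enc_prod_inj {A B} `{Enc A} `{Enc B} (p q : A * B) :
  npair (enc (fst p)) (enc (snd p)) = npair (enc (fst q)) (enc (snd q)) -> p = q.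
Proof.
  destruct p, q; intros E; apply npair_inj in E as [E1 E2]; f_equal; now apply enc_inj.
Qed.
#[global] Instance Enc_prod A B `{Enc A} `{Enc B} : Enc (A * B) :=
  {| enc := fun p => npair (enc (fst p)) (enc (snd p)); enc_inj := enc_prod_inj |}.

Lemma enc_list_inj {A} `{Enc A} (l m : list A) :
  fold_right (fun a n => S (npair (enc a) n)) 0 l =
  fold_right (fun a n => S (npair (enc a) n)) 0 m ->
  l = m.
Proof.
  revert m; induction l as [|x l IH]; intros [|y m]; simpl; try discriminate; auto.
  intros E; injection E as E; apply npair_inj in E as [E1 E2].
  f_equal; [now apply enc_inj | now apply IH].
Qed.
#[global] Instance Enc_list A `{Enc A} : Enc (list A) :=
  {| enc := fold_right (fun a n => S (npair (enc a) n)) 0; enc_inj := enc_list_inj |}.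

Definition Cmp {A B} `{Enc A} `{Enc B} (f : A -> B) : Prop :=
  exists F, computable1 F /\ forall a, F (enc a) = enc (f a).

Section Basic_closure.
Context {G A B C D : Type} `{Enc G} `{Enc A} `{Enc B} `{Enc C} `{Enc D}.

Lemma cmp_id : Cmp (fun g : G => g).
Proof. exists (fun n => n); split; auto using computable1_id. Qed.

Lemma cmp_const (a : A) : Cmp (fun _ : G => a).
Proof. exists (fun _ => enc a); split; auto using computable1_const. Qed.

Lemma cmp_ext (f f' : G -> A) : (forall g, f g = f' g) -> Cmp f -> Cmp f'.
Proof. intros E (F & HF & HE); exists F; split; auto; intros; rewrite <- E; auto. Qed.

Lemma cmp_comp (f : A -> B) (g : G -> A) : Cmp f -> Cmp g -> Cmp (fun x => f (g x)).
Proof.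
  intros (F & HF & EF) (K & HK & EK); exists (fun n => F (K n)); split.
  - now apply computable1_comp.
  - intros; now rewrite EK, EF.
Qed.

Lemma cmp_pair (f : G -> A) (g : G -> B) : Cmp f -> Cmp g -> Cmp (fun x => (f x, g x)).
Proof.
  intros (F & HF & EF) (K & HK & EK); exists (fun n => npair (F n) (K n)); split.
  - now apply computable1_npair.
  - intros; now rewrite EK, EF.
Qed.

Lemma cmp_fst (f : G -> A * B) : Cmp f -> Cmp (fun x => fst (f x)).
Proof.
  intros (F & HF & EF); exists (fun n => fstn (F n)); split.
  - apply computable1_comp; auto using computable1_fst.
  - intros; rewrite EF; apply fstn_npair.
Qed.

Lemma cmp_snd (f : G -> A * B) : Cmp f -> Cmp (fun x => snd (f x)).
Proof.
  intros (F & HF & EF); exists (fun n => sndn (F n)); split.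
  - apply computable1_comp; auto using computable1_snd.
  - intros; rewrite EF; apply sndn_npair.
Qed.

Lemma cmp_nat_rect (f : G -> A) (s : G -> nat -> A -> A) (n : G -> nat) :
  Cmp f -> Cmp (fun q : G * (nat * A) => s (fst q) (fst (snd q)) (snd (snd q))) -> Cmp n ->
  Cmp (fun g => nat_rect (fun _ => A) (f g) (s g) (n g)).
Proof.
  intros (F & HF & EF) (K & HK & EK) (N & HN & EN).
  exists (fun n => nat_rect (fun _ => nat) (F n) (fun k a => K (npair n (npair k a))) (N n)); split.
  - now apply computable1_rec.
  - intros g; rewrite EN; simpl; induction (n g) as [|k IH]; simpl; auto.
    rewrite IH; apply (EK (g, (k, _))).
Qed.

Lemma cmp_nat_case (f : G -> A) (s : G -> nat -> A) (n : G -> nat) :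
  Cmp f -> Cmp (fun q : G * nat => s (fst q) (snd q)) -> Cmp n ->
  Cmp (fun g => match n g with 0 => f g | S k => s g k end).
Proof.
  intros (F & HF & EF) (K & HK & EK) (N & HN & EN).
  exists (fun n => nat_rect (fun _ => nat) (F n)
    (fun k a => (fun m => K (npair (fstn m) (fstn (sndn m)))) (npair n (npair k a))) (N n)); split.
  - apply (computable1_rec F (fun m => K (npair (fstn m) (fstn (sndn m)))) N HF); auto.
    apply computable1_comp; auto; apply computable1_npair;
      auto using computable1_fst, computable1_snd, computable1_comp.
  - intros g; rewrite EN; simpl; destruct (n g) as [|k]; simpl; auto.
    rewrite !sndn_npair, !fstn_npair; apply (EK (g, k)).
Qed.

(** A nonempty list is coded by the successor of the code of the pair of its head and tail, so this
    is a case distinction on a number: a recursion that discards the recursive value. *)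
Lemma cmp_list_case (f : G -> A) (s : G -> B -> list B -> A) (l : G -> list B) :
  Cmp f -> Cmp (fun q : G * (B * list B) => s (fst q) (fst (snd q)) (snd (snd q))) -> Cmp l ->
  Cmp (fun g => match l g with [] => f g | b :: l' => s g b l' end).
Proof.
  intros (F & HF & EF) (K & HK & EK) (N & HN & EN).
  exists (fun n => nat_rect (fun _ => nat) (F n)
    (fun k a => (fun m => K (npair (fstn m) (fstn (sndn m)))) (npair n (npair k a))) (N n)); split.
  - apply (computable1_rec F (fun m => K (npair (fstn m) (fstn (sndn m)))) N HF); auto.
    apply computable1_comp; auto; apply computable1_npair;
      auto using computable1_fst, computable1_snd, computable1_comp.
  - intros g; rewrite EN; simpl; destruct (l g) as [|b l']; simpl; auto.
    rewrite !sndn_npair, !fstn_npair; apply (EK (g, (b, l'))).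
Qed.

Lemma cmp_cons (f : G -> A) (l : G -> list A) : Cmp f -> Cmp l -> Cmp (fun g => f g :: l g).
Proof.
  intros (F & HF & EF) (K & HK & EK); exists (fun n => S (npair (F n) (K n))); split.
  - apply computable1_comp; auto using computable1_S; now apply computable1_npair.
  - intros; now rewrite EK, EF.
Qed.

Lemma cmp_S (f : G -> nat) : Cmp f -> Cmp (fun g => S (f g)).
Proof.
  intros (F & HF & EF); exists (fun n => S (F n)); split.
  - apply computable1_comp; auto using computable1_S.
  - intros; now rewrite EF.
Qed.

Lemma cmp_if (b : G -> bool) (f g : G -> A) :
  Cmp b -> Cmp f -> Cmp g -> Cmp (fun x => if b x then f x else g x).
Proof.
  intros (N & HN & EN) (F & HF & EF) (K & HK & EK).
  exists (fun n => nat_rect (fun _ => nat) (K n) (fun k a => F (fstn (npair n (npair k a)))) (N n)).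
  split.
  - apply (computable1_rec K (fun m => F (fstn m)) N); auto.
    apply computable1_comp; auto using computable1_fst.
  - intros x; rewrite EN; simpl; destruct (b x); simpl; auto.
    now rewrite fstn_npair.
Qed.

Lemma cmp_pred (f : G -> nat) : Cmp f -> Cmp (fun g => Nat.pred (f g)).
Proof.
  intros (F & HF & EF); exists (fun n => Nat.pred (F n)); split.
  - apply computable1_comp; auto using computable1_pred.
  - intros; now rewrite EF.
Qed.

Lemma cmp_add (f g : G -> nat) : Cmp f -> Cmp g -> Cmp (fun x => f x + g x).
Proof.
  intros (F & HF & EF) (K & HK & EK); exists (fun n => F n + K n); split.
  - exact (computable1_comp2 _ _ _ computable2_add HF HK).
  - intros; now rewrite EK, EF.
Qed.

Lemma cmp_sub (f g : G -> nat) : Cmp f -> Cmp g -> Cmp (fun x => f x - g x).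
Proof.
  intros (F & HF & EF) (K & HK & EK); exists (fun n => F n - K n); split.
  - exact (computable1_comp2 _ _ _ computable2_sub HF HK).
  - intros; now rewrite EK, EF.
Qed.

Lemma cmp_enc (f : G -> A) : Cmp f -> Cmp (fun g => enc (f g)).
Proof. intros (F & HF & EF); now exists F. Qed.

End Basic_closure.

(* The goal is matched syntactically: [apply cmp_enc] would loop, as [enc] is the identity on
   [nat]. *)
Ltac cmp_base1 :=
  match goal with
  | _ => assumption
  | |- Cmp (fun x => x) => apply cmp_id
  | |- Cmp (fun _ => ?a) => apply (cmp_const a)
  | |- Cmp fst => apply (cmp_fst (fun q => q))
  | |- Cmp snd => apply (cmp_snd (fun q => q))
  | |- Cmp (fun x => fst (@?f x)) => apply (cmp_fst f)
  | |- Cmp (fun x => snd (@?f x)) => apply (cmp_snd f)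
  | |- Cmp (fun x => (@?f x, @?g x)) => apply (cmp_pair f g)
  | |- Cmp (fun x => (@?f x) :: (@?g x)) => apply (cmp_cons f g)
  | |- Cmp (fun x => S (@?f x)) => apply (cmp_S f)
  | |- Cmp (fun x => Nat.pred (@?f x)) => apply (cmp_pred f)
  | |- Cmp (fun x => (@?f x) + (@?g x)) => apply (cmp_add f g)
  | |- Cmp (fun x => (@?f x) - (@?g x)) => apply (cmp_sub f g)
  | |- Cmp (fun x => enc (@?f x)) => apply (cmp_enc f)
  end.
Ltac cmp_base := repeat (cbv beta; cmp_base1).

Definition eqe {A} `{Enc A} (a b : A) : bool := Nat.eqb (enc a) (enc b).

Lemma eqe_spec {A} `{Enc A} (a b : A) : eqe a b = true <-> a = b.
Proof.
  unfold eqe; rewrite Nat.eqb_eq; split; [apply enc_inj | congruence].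
Qed.

Section Tests_and_iteration.
Context {G A B : Type} `{Enc G} `{Enc A} `{Enc B}.

Lemma cmp_negb (b : G -> bool) : Cmp b -> Cmp (fun x => negb (b x)).
Proof. intros; apply (cmp_if b (fun _ => false) (fun _ => true)); cmp_base. Qed.

Lemma cmp_andb (b c : G -> bool) : Cmp b -> Cmp c -> Cmp (fun x => b x && c x).
Proof. intros; apply (cmp_if b c (fun _ => false)); cmp_base. Qed.

Lemma cmp_leb (f g : G -> nat) : Cmp f -> Cmp g -> Cmp (fun x => f x <=? g x).
Proof.
  intros Hf Hg.
  apply (cmp_ext (fun x => match f x - g x with 0 => true | S _ => false end)).
  - intros x; symmetry; destruct (f x - g x) eqn:E.
    + apply Nat.leb_le; lia.
    + apply Nat.leb_gt; lia.
  - apply (cmp_nat_case (fun _ => true) (fun _ _ => false)); cmp_base.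
Qed.

Lemma cmp_ltb (f g : G -> nat) : Cmp f -> Cmp g -> Cmp (fun x => f x <? g x).
Proof. intros; apply cmp_leb; cmp_base. Qed.

Lemma cmp_eqb (f g : G -> nat) : Cmp f -> Cmp g -> Cmp (fun x => f x =? g x).
Proof.
  intros Hf Hg; apply (cmp_ext (fun x => (f x <=? g x) && (g x <=? f x))).
  - intros x; destruct (Nat.eqb_spec (f x) (g x)).
    + rewrite e, Nat.leb_refl; auto.
    + destruct (Nat.leb_spec (f x) (g x)); auto; simpl; apply Nat.leb_gt; lia.
  - auto using cmp_andb, cmp_leb.
Qed.

Lemma cmp_eqe (f g : G -> A) : Cmp f -> Cmp g -> Cmp (fun x => eqe (f x) (g x)).
Proof. intros; apply cmp_eqb; cmp_base. Qed.

Lemma cmp_max (f g : G -> nat) : Cmp f -> Cmp g -> Cmp (fun x => Nat.max (f x) (g x)).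
Proof.
  intros; apply (cmp_ext (fun x => f x + (g x - f x))); [intros; lia|].
  cmp_base.
Qed.

Lemma cmp_hd (d : A) (l : G -> list A) : Cmp l -> Cmp (fun x => hd d (l x)).
Proof.
  intros; apply (cmp_list_case (fun _ => d) (fun _ b _ => b)); cmp_base.
Qed.

Lemma cmp_tl (l : G -> list A) : Cmp l -> Cmp (fun x => tl (l x)).
Proof.
  intros; apply (cmp_list_case (fun _ => []) (fun _ _ b => b)); cmp_base.
Qed.

Lemma cmp_iter (f : G -> A -> A) (n : G -> nat) (a : G -> A) :
  Cmp n -> Cmp (fun q : G * A => f (fst q) (snd q)) -> Cmp a ->
  Cmp (fun x => Nat.iter (n x) (f x) (a x)).
Proof.
  intros Hn Hf Ha.
  apply (cmp_nat_rect a (fun x _ => f x) n); auto.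
  apply (cmp_comp (fun q : G * A => f (fst q) (snd q))
           (fun q : G * (nat * A) => (fst q, snd (snd q)))); cmp_base.
Qed.

Lemma length_le_enc (l : list A) : length l <= enc l.
Proof.
  induction l as [|a l IH]; simpl in *; [lia|].
  apply le_n_S; etransitivity; [exact IH | apply npair_ge_r].
Qed.

End Tests_and_iteration.

Section Left_folds.
Context {G A B : Type} `{Enc G} `{Enc A} `{Enc B}.

(** The step consumes one entry and idles on the empty list, so any number of rounds from the length
    on yields the fold; by [length_le_enc] the code of the list is such a number. *)
Lemma cmp_fold_left (f : G -> B -> A -> B) (l : G -> list A) (b : G -> B) :
  Cmp (fun q : G * (B * A) => f (fst q) (fst (snd q)) (snd (snd q))) -> Cmp l -> Cmp b ->
  Cmp (fun x => fold_left (f x) (l x) (b x)).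
Proof.
  intros Hf Hl Hb.
  set (step := fun (x : G) (st : list A * B) =>
    match fst st with [] => st | a :: l' => (l', f x (snd st) a) end).
  assert (St : forall x n l b, length l <= n ->
            Nat.iter n (step x) (l, b) = ([], fold_left (f x) l b)).
  { intros x; induction n as [|n IH]; intros l1 b1 L.
    - destruct l1; [reflexivity | simpl in L; lia].
    - rewrite Nat.iter_succ_r; destruct l1 as [|a l1].
      + apply (IH [] b1); simpl; lia.
      + simpl in L; apply (IH l1); lia. }
  apply (cmp_ext (fun x => snd (Nat.iter (enc (l x)) (step x) (l x, b x)))).
  - intros x; rewrite St; auto using length_le_enc.
  - apply cmp_snd, (cmp_iter step); cmp_base.
    apply (cmp_list_case (fun q : G * (list A * B) => snd q)
             (fun q a l' => (l', f (fst q) (snd (snd q)) a))); cmp_base.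
    apply (cmp_comp (fun q : G * (B * A) => f (fst q) (fst (snd q)) (snd (snd q)))
      (fun q : (G * (list A * B)) * (A * list A) =>
         (fst (fst q), (snd (snd (fst q)), fst (snd q))))); auto.
    cmp_base.
Qed.
End Left_folds.

Section Right_folds.
Context {G A B : Type} `{Enc G} `{Enc A} `{Enc B}.

Lemma cmp_rev (l : G -> list A) : Cmp l -> Cmp (fun x => rev (l x)).
Proof.
  intros Hl; apply (cmp_ext (fun x => fold_left (fun acc a => a :: acc) (l x) [])).
  - intros x; symmetry; rewrite <- fold_left_rev_right, <- (rev_involutive (l x)) at 1.
    generalize (rev (l x)); intros m; rewrite rev_involutive.
    induction m; simpl; congruence.
  - apply (cmp_fold_left (fun _ acc a => a :: acc)); cmp_base.
Qed.

Lemma cmp_fold_right (f : G -> A -> B -> B) (l : G -> list A) (b : G -> B) :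
  Cmp (fun q : G * (A * B) => f (fst q) (fst (snd q)) (snd (snd q))) -> Cmp l -> Cmp b ->
  Cmp (fun x => fold_right (f x) (b x) (l x)).
Proof.
  intros Hf Hl Hb.
  apply (cmp_ext (fun x => fold_left (fun b a => f x a b) (rev (l x)) (b x))).
  - intros x; now rewrite <- fold_left_rev_right, rev_involutive.
  - apply (cmp_fold_left (fun x b a => f x a b)); [|now apply cmp_rev|assumption].
    apply (cmp_comp (fun q : G * (A * B) => f (fst q) (fst (snd q)) (snd (snd q)))
      (fun q : G * (B * A) => (fst q, (snd (snd q), fst (snd q))))); auto.
    cmp_base.
Qed.
End Right_folds.

Section List_functions.
Context {G A : Type} `{Enc G} `{Enc A}.

Lemma cmp_app (l m : G -> list A) : Cmp l -> Cmp m -> Cmp (fun x => l x ++ m x).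
Proof.
  intros; apply (cmp_ext (fun x => fold_right cons (m x) (l x))).
  - intros x; induction (l x); simpl; congruence.
  - apply (cmp_fold_right (fun _ => cons)); cmp_base.
Qed.

Lemma cmp_length (l : G -> list A) : Cmp l -> Cmp (fun x => length (l x)).
Proof.
  intros; apply (cmp_ext (fun x => fold_right (fun _ => S) 0 (l x))).
  - intros x; induction (l x); simpl; congruence.
  - apply (cmp_fold_right (fun _ _ => S)); cmp_base.
Qed.

Lemma cmp_forallb (f : G -> A -> bool) (l : G -> list A) :
  Cmp (fun q : G * A => f (fst q) (snd q)) -> Cmp l -> Cmp (fun x => forallb (f x) (l x)).
Proof.
  intros Hf Hl; apply (cmp_ext (fun x => fold_right (fun a b => f x a && b) true (l x))).
  - intros x; induction (l x); simpl; congruence.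
  - apply (cmp_fold_right (fun x a b => f x a && b)); cmp_base.
    apply cmp_andb; cmp_base.
    apply (cmp_comp (fun q : G * A => f (fst q) (snd q))
      (fun q : G * (A * bool) => (fst q, fst (snd q)))); cmp_base.
Qed.

Lemma nth_iter_tl (l : list A) (d : A) n : hd d (Nat.iter n (@tl A) l) = nth n l d.
Proof.
  revert l; induction n; intros l; [now destruct l|].
  rewrite Nat.iter_succ_r, IHn; destruct l; [now destruct n | reflexivity].
Qed.

Lemma cmp_nth (d : A) (n : G -> nat) (l : G -> list A) :
  Cmp n -> Cmp l -> Cmp (fun x => nth (n x) (l x) d).
Proof.
  intros; apply (cmp_ext (fun x => hd d (Nat.iter (n x) (@tl A) (l x)))).
  - intros; apply nth_iter_tl.
  - apply cmp_hd, (cmp_iter (fun _ => @tl A) n l); cmp_base.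
    apply (cmp_tl (fun q : G * list A => snd q)); cmp_base.
Qed.
End List_functions.

(** * Arithmetic, bits and bounded search *)

Lemma cmp_odd {G} `{Enc G} (n : G -> nat) : Cmp n -> Cmp (fun x => Nat.odd (n x)).
Proof.
  intros; apply (cmp_ext (fun x => nat_rect (fun _ => bool) false (fun _ b => negb b) (n x))).
  - intros x; induction (n x) as [|k IH]; [reflexivity|].
    rewrite Nat.odd_succ, <- Nat.negb_odd; simpl; congruence.
  - apply (cmp_nat_rect (fun _ => false) (fun _ _ b => negb b)); cmp_base.
    apply cmp_negb, cmp_snd, cmp_snd, cmp_id.
Qed.

Lemma cmp_div2 {G} `{Enc G} (n : G -> nat) : Cmp n -> Cmp (fun x => Nat.div2 (n x)).
Proof.
  intros; apply (cmp_ext (fun x => nat_rect (fun _ => nat) 0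
                   (fun k r => if Nat.odd k then S r else r) (n x))).
  - intros x; induction (n x) as [|k IH]; [reflexivity|]; simpl nat_rect; rewrite IH.
    pose proof (Nat.div2_odd k) as E1; pose proof (Nat.div2_odd (S k)) as E2.
    rewrite Nat.odd_succ, <- Nat.negb_odd in E2.
    destruct (Nat.odd k); simpl Nat.b2n in *; simpl negb in *; lia.
  - apply (cmp_nat_rect (fun _ => 0) (fun _ k r => if Nat.odd k then S r else r)); cmp_base.
    apply cmp_if; cmp_base; apply cmp_odd; cmp_base.
Qed.

Lemma cmp_testbit {G} `{Enc G} (n i : G -> nat) :
  Cmp n -> Cmp i -> Cmp (fun x => Nat.testbit (n x) (i x)).
Proof.
  intros; apply (cmp_ext (fun x => Nat.odd (Nat.iter (i x) Nat.div2 (n x)))).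
  - intros x; generalize (n x); induction (i x) as [|k IH]; intros m; [reflexivity|].
    rewrite Nat.iter_succ_r, IH; reflexivity.
  - apply cmp_odd, (cmp_iter (fun _ => Nat.div2) i n); cmp_base.
    apply cmp_div2; cmp_base.
Qed.

Lemma cmp_mod7 {G} `{Enc G} (n : G -> nat) : Cmp n -> Cmp (fun x => n x mod 7).
Proof.
  intros; apply (cmp_ext (fun x => nat_rect (fun _ => nat) 0
                   (fun _ r => if r =? 6 then 0 else S r) (n x))).
  - intros x; induction (n x) as [|k IH]; [reflexivity|]; simpl nat_rect; rewrite IH.
    destruct (Nat.eqb_spec (k mod 7) 6).
    + apply (Nat.mod_unique _ _ (S (k / 7))); pose proof (Nat.div_mod_eq k 7); lia.
    + pose proof (Nat.mod_upper_bound k 7).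
      apply (Nat.mod_unique _ _ (k / 7)); pose proof (Nat.div_mod_eq k 7); lia.
  - apply (cmp_nat_rect (fun _ => 0) (fun _ _ r => if r =? 6 then 0 else S r)); cmp_base.
    apply cmp_if; cmp_base; apply cmp_eqb; cmp_base.
Qed.

(** An accumulator equal to the counter [k] records that no witness below [k] was found; the value
    [n] therefore means failure. *)
Definition first_below (P : nat -> bool) (n : nat) : nat :=
  nat_rect (fun _ => nat) 0 (fun k r => if r =? k then (if P k then k else S k) else r) n.

Lemma first_below_spec P n :
  first_below P n <= n /\ (first_below P n < n -> P (first_below P n) = true) /\
  forall k, k < first_below P n -> P k = false.
Proof.
  induction n as [|n (IH1 & IH2 & IH3)]; simpl; [repeat split; lia|].
  change (nat_rect _ 0 _ n) with (first_below P n).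
  destruct (Nat.eqb_spec (first_below P n) n) as [E|E].
  - rewrite E in *; destruct (P n) eqn:Pn; repeat split; auto; try lia.
    intros k L; destruct (Nat.eq_dec k n); [subst; auto | apply IH3; lia].
  - repeat split; auto; try lia; intros; apply IH2; lia.
Qed.

Lemma cmp_first_below {G} `{Enc G} (P : G -> nat -> bool) (n : G -> nat) :
  Cmp (fun q : G * nat => P (fst q) (snd q)) -> Cmp n -> Cmp (fun x => first_below (P x) (n x)).
Proof.
  intros HP Hn.
  apply (cmp_nat_rect (fun _ => 0) (fun x k r => if r =? k then (if P x k then k else S k) else r));
    cmp_base.
  apply cmp_if; cmp_base; [apply cmp_eqb; cmp_base|].
  apply cmp_if; cmp_base.
  apply (cmp_comp (fun q : G * nat => P (fst q) (snd q))
    (fun q : G * (nat * nat) => (fst q, fst (snd q)))); cmp_base.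
Qed.

Ltac cmp_user := fail.
Ltac cmp_step :=
  first [ cmp_base1 | cmp_user |
  match goal with
  | |- Cmp (fun x => Nat.max (@?f x) (@?g x)) => apply (cmp_max f g)
  | |- Cmp (fun x => negb (@?f x)) => apply (cmp_negb f)
  | |- Cmp (fun x => andb (@?f x) (@?g x)) => apply (cmp_andb f g)
  | |- Cmp (fun x => Nat.ltb (@?f x) (@?g x)) => apply (cmp_ltb f g)
  | |- Cmp (fun x => Nat.leb (@?f x) (@?g x)) => apply (cmp_leb f g)
  | |- Cmp (fun x => Nat.eqb (@?f x) (@?g x)) => apply (cmp_eqb f g)
  | |- Cmp (fun x => eqe (@?f x) (@?g x)) => apply (cmp_eqe f g)
  | |- Cmp (fun x => hd ?d (@?f x)) => apply (cmp_hd d f)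
  | |- Cmp (fun x => tl (@?f x)) => apply (cmp_tl f)
  | |- Cmp (fun x => (@?f x) ++ (@?g x)) => apply (cmp_app f g)
  | |- Cmp (fun x => length (@?f x)) => apply (cmp_length f)
  | |- Cmp (fun x => nth (@?f x) (@?g x) ?d) => apply (cmp_nth d f g)
  | |- Cmp (fun x => Nat.testbit (@?f x) (@?g x)) => apply (cmp_testbit f g)
  | |- Cmp (fun x => (@?f x) mod 7) => apply (cmp_mod7 f)
  | |- Cmp (fun x => forallb (@?f x) (@?g x)) => apply (cmp_forallb f g)
  | |- Cmp (fun x => first_below (@?f x) (@?g x)) => apply (cmp_first_below f g)
  | |- Cmp (fun x => Nat.iter (@?n x) (@?f x) (@?a x)) => apply (cmp_iter f n a)
  | |- Cmp (fun x => fold_right (@?f x) (@?a x) (@?l x)) => apply (cmp_fold_right f l a)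
  | |- Cmp (fun x => if @?b x then @?f x else @?g x) => apply (cmp_if b f g)
  | |- Cmp (fun x => nat_rect _ (@?f x) (@?s x) (@?n x)) => apply (cmp_nat_rect f s n)
  | |- Cmp (fun x => match @?n x with 0 => @?f x | S k => @?s x k end) =>
      apply (cmp_nat_case f s n)
  | |- Cmp (fun x => match @?n x with nil => @?f x | cons a l => @?s x a l end) =>
      apply (cmp_list_case f s n)
  | E : Cmp ?n |- Cmp (fun x => ?n (@?f x)) => apply (cmp_comp n f E)
  | E : Cmp (fun q => ?F (fst q) (snd q)) |- Cmp (fun x => ?F (@?f x) (@?g x)) =>
      apply (cmp_comp (fun q => F (fst q) (snd q)) (fun x => (f x, g x)) E)
  end ].
Ltac cmp := repeat (cbv beta; cmp_step).

(** * A universal stack machine *)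

Fixpoint declist (fuel n : nat) : list nat :=
  match fuel, n with
  | S fuel, S n => fstn n :: declist fuel (sndn n)
  | _, _ => []
  end.

Lemma enc_declist fuel n : n <= fuel -> enc (declist fuel n) = n.
Proof.
  revert n; induction fuel as [|fuel IH]; intros [|n] L; try reflexivity; [lia|].
  change (S (npair (fstn n) (enc (declist fuel (sndn n)))) = S n).
  rewrite IH, npair_surj; auto.
  pose proof (npair_ge_r (fstn n) (sndn n)); rewrite npair_surj in *; lia.
Qed.

Definition decp (n : nat) : nat * list nat := (fstn n, declist (sndn n) (sndn n)).

Lemma enc_decp n : enc (decp n) = n.
Proof.
  change (npair (fstn n) (enc (declist (sndn n) (sndn n))) = n).
  rewrite enc_declist; auto using npair_surj.
Qed.

Lemma decp_enc a : decp (enc a) = a.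
Proof. apply enc_inj, enc_decp. Qed.

(** Every number is the code of what it decodes to, so decoding leaves the underlying number
    unchanged. *)
Lemma cmp_decp {G} `{Enc G} (n : G -> nat) : Cmp n -> Cmp (fun x => decp (n x)).
Proof.
  intros (F & HF & EF); exists F; split; auto; intros; rewrite enc_decp; apply EF.
Qed.

(* The arguments of a composition are stored in reverse, so that consing their values
   restores the order. *)
Fixpoint pcode (p : PR) : nat :=
  match p with
  | PRzero => enc (0, @nil nat)
  | PRsucc => enc (1, @nil nat)
  | PRproj i => enc (2, [i])
  | PRcomp f gs => enc (3, pcode f :: rev (map pcode gs))
  | PRprec f g => enc (4, [pcode f; pcode g])
  | PRmu f => enc (5, [pcode f])
  end.

(* A frame (tag, (program, (arguments left, (vector, counters)))) waits for a value: tag 0 is a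
   composition collecting values in its last field, tag 1 a recursion at step i of n with last
   field [i; n], tag 2 a minimization with last field [i]. *)
Definition frame := (nat * (nat * (list nat * (list nat * list nat))))%type.
Definition mstate := (bool * (nat * (list nat * (nat * list frame))))%type.
Definition eval_state (p : nat) (v : list nat) (K : list frame) : mstate :=
  (true, (p, (v, (0, K)))).
Definition ret_state (y : nat) (K : list frame) : mstate := (false, (0, ([], (y, K)))).

Definition mcomp (f : nat) (gs v acc : list nat) (K : list frame) : mstate :=
  match gs with
  | [] => eval_state f acc K
  | g :: gs' => eval_state g v ((0, (f, (gs', (v, acc)))) :: K)
  end.

Definition meval (st : mstate) (tg : nat) (args v : list nat) (K : list frame) : mstate :=
  if tg =? 0 then ret_state 0 K
  else if tg =? 1 then ret_state (S (hd 0 v)) K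
  else if tg =? 2 then ret_state (nth (hd 0 args) v 0) K
  else if tg =? 3 then mcomp (hd 0 args) (tl args) v [] K
  else if tg =? 4 then
    match v with
    (* [evalPR] assigns no value to a recursion on the empty vector, so the machine has to diverge:
       it stays in this state. *)
    | [] => st
    | x :: v' => eval_state (hd 0 args) v' ((1, (nth 1 args 0, ([], (v', [0; x])))) :: K)
    end
  else eval_state (hd 0 args) (0 :: v) ((2, (hd 0 args, ([], (v, [0])))) :: K).

Definition mret (tg a : nat) (gs v acc : list nat) (y : nat) (K : list frame) : mstate :=
  if tg =? 0 then mcomp a gs v (y :: acc) K
  else if tg =? 1 then
    if hd 0 acc =? nth 1 acc 0 then ret_state y K
    else eval_state a (hd 0 acc :: y :: v) ((1, (a, ([], (v, [S (hd 0 acc); nth 1 acc 0])))) :: K)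
  else if y =? 0 then ret_state (hd 0 acc) K
  else eval_state a (S (hd 0 acc) :: v) ((2, (a, ([], (v, [S (hd 0 acc)])))) :: K).

Definition mstep (st : mstate) : mstate :=
  if fst st then
    meval st (fst (decp (fst (snd st)))) (snd (decp (fst (snd st)))) (fst (snd (snd st)))
      (snd (snd (snd (snd st))))
  else
    match snd (snd (snd (snd st))) with
    | [] => st
    | fr :: K => mret (fst fr) (fst (snd fr)) (fst (snd (snd fr))) (fst (snd (snd (snd fr))))
                   (snd (snd (snd (snd fr)))) (fst (snd (snd (snd st)))) K
    end.

Definition halted (st : mstate) : bool :=
  negb (fst st) && (length (snd (snd (snd (snd st)))) =? 0).

Definition haltsin (n : nat) (st : mstate) : bool := halted (Nat.iter n mstep st).

Ltac cmp_user ::=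
  match goal with |- Cmp (fun x => decp (@?f x)) => apply (cmp_decp f) end.

Lemma cmp_mstep {G} `{Enc G} (f : G -> mstate) : Cmp f -> Cmp (fun x => mstep (f x)).
Proof.
  intros Hf; apply (cmp_comp mstep f); auto.
  unfold mstep, meval, mret, mcomp, eval_state, ret_state.
  cmp.
Qed.

Lemma cmp_haltsin {G} `{Enc G} (n : G -> nat) (f : G -> mstate) :
  Cmp n -> Cmp f -> Cmp (fun x => haltsin (n x) (f x)).
Proof.
  intros Hn Hf; unfold haltsin, halted.
  assert (Cmp (fun x => Nat.iter (n x) mstep (f x))).
  { apply (cmp_iter (fun _ => mstep)); auto; apply (cmp_mstep (fun q : G * mstate => snd q)); cmp. }
  cmp.
Qed.

(** * Correctness of the machine *)

Definition reach (s t : mstate) : Prop := exists n, Nat.iter n mstep s = t.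

Lemma reach_refl s : reach s s.
Proof. now exists 0. Qed.

Lemma reach_trans s t u : reach s t -> reach t u -> reach s u.
Proof.
  intros [n E1] [m E2]; exists (m + n); rewrite Nat.iter_add; now rewrite E1.
Qed.

Lemma reach_step s t u : mstep s = t -> reach t u -> reach s u.
Proof. intros E; apply reach_trans; now exists 1. Qed.

Lemma mstep_zero v K : mstep (eval_state (pcode PRzero) v K) = ret_state 0 K.
Proof. unfold mstep, eval_state; cbn [pcode fst snd]; now rewrite decp_enc. Qed.
Lemma mstep_succ v K : mstep (eval_state (pcode PRsucc) v K) = ret_state (S (hd 0 v)) K.
Proof. unfold mstep, eval_state; cbn [pcode fst snd]; now rewrite decp_enc. Qed.
Lemma mstep_proj i v K : mstep (eval_state (pcode (PRproj i)) v K) = ret_state (nth i v 0) K.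
Proof. unfold mstep, eval_state; cbn [pcode fst snd]; now rewrite decp_enc. Qed.
Lemma mstep_comp f gs v K :
  mstep (eval_state (pcode (PRcomp f gs)) v K) = mcomp (pcode f) (rev (map pcode gs)) v [] K.
Proof. unfold mstep, eval_state; cbn [pcode fst snd]; now rewrite decp_enc. Qed.
Lemma mstep_prec f g x v K :
  mstep (eval_state (pcode (PRprec f g)) (x :: v) K) =
  eval_state (pcode f) v ((1, (pcode g, ([], (v, [0; x])))) :: K).
Proof. unfold mstep, eval_state; cbn [pcode fst snd]; now rewrite decp_enc. Qed.
Lemma mstep_prec_nil f g K :
  mstep (eval_state (pcode (PRprec f g)) [] K) = eval_state (pcode (PRprec f g)) [] K.
Proof. unfold mstep, eval_state; cbn [pcode fst snd]; now rewrite decp_enc. Qed.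
Lemma mstep_mu f v K :
  mstep (eval_state (pcode (PRmu f)) v K) =
  eval_state (pcode f) (0 :: v) ((2, (pcode f, ([], (v, [0])))) :: K).
Proof. unfold mstep, eval_state; cbn [pcode fst snd]; now rewrite decp_enc. Qed.

Lemma mstep_ret_prec y g v i X K :
  mstep (ret_state y ((1, (g, ([], (v, [i; X])))) :: K)) =
  if i =? X then ret_state y K else eval_state g (i :: y :: v) ((1, (g, ([], (v, [S i; X])))) :: K).
Proof. reflexivity. Qed.

(** A derivation for [S x] rounds of a recursion contains one for [x] rounds, but the machine runs a
    single loop whose frame holds the final bound [X]. Hence the second clause: the loop runs up to
    round [x] under every bound [X >= x]. *)
Definition preach (p : PR) (v : list nat) (y : nat) : Prop :=
  (forall K, reach (eval_state (pcode p) v K) (ret_state y K)) /\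
  match p, v with
  | PRprec f g, x :: v' =>
      forall X K, x <= X ->
      reach (eval_state (pcode f) v' ((1, (pcode g, ([], (v', [0; X])))) :: K))
            (ret_state y ((1, (pcode g, ([], (v', [x; X])))) :: K))
  | _, _ => True
  end.

Lemma preach_prec f g x v y :
  (forall X K, x <= X ->
      reach (eval_state (pcode f) v ((1, (pcode g, ([], (v, [0; X])))) :: K))
            (ret_state y ((1, (pcode g, ([], (v, [x; X])))) :: K))) ->
  preach (PRprec f g) (x :: v) y.
Proof.
  intros HX; split; auto; intros K.
  eapply reach_step; [apply mstep_prec|].
  eapply reach_trans; [apply HX; auto|].
  eapply reach_step; [|apply reach_refl].
  now rewrite mstep_ret_prec, Nat.eqb_refl.
Qed.

Lemma preach_comp f gs v ws y :
  Forall2 (fun g w => preach g v w) gs ws -> preach f ws y -> preach (PRcomp f gs) v y.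
Proof.
  intros Hgs Hf; split; auto; intros K.
  eapply reach_step; [apply mstep_comp|].
  assert (M : forall rgs rws acc,
    Forall2 (fun g w => preach g v w) rgs rws ->
    reach (mcomp (pcode f) (map pcode rgs) v acc K) (eval_state (pcode f) (rev rws ++ acc) K)).
  { intros rgs rws acc Hr; revert acc; induction Hr as [|g w rgs rws [Hg _] Hr IH]; intros acc.
    - apply reach_refl.
    - eapply reach_trans; [apply Hg|].
      eapply reach_step; [reflexivity|].
      cbn [rev]; rewrite <- app_assoc; apply IH. }
  assert (Hr : Forall2 (fun g w => preach g v w) (rev gs) (rev ws)).
  { clear -Hgs; induction Hgs; simpl; auto using Forall2_app. }
  rewrite <- map_rev; eapply reach_trans; [apply (M _ _ _ Hr)|].
  rewrite rev_involutive, app_nil_r; apply Hf.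
Qed.

Lemma preach_mu f v n :
  preach f (n :: v) 0 -> (forall m, m < n -> exists k, preach f (m :: v) (S k)) ->
  preach (PRmu f) v n.
Proof.
  intros [H0 _] Hm; split; auto; intros K.
  eapply reach_step; [apply mstep_mu|].
  assert (M : forall i, i <= n ->
    reach (eval_state (pcode f) (0 :: v) ((2, (pcode f, ([], (v, [0])))) :: K))
          (eval_state (pcode f) (i :: v) ((2, (pcode f, ([], (v, [i])))) :: K))).
  { induction i as [|i IH]; intros L; [apply reach_refl|].
    eapply reach_trans; [apply IH; lia|].
    destruct (Hm i L) as (k & Hk & _).
    eapply reach_trans; [apply Hk|].
    eapply reach_step; [reflexivity|apply reach_refl]. }
  eapply reach_trans; [apply (M n); auto|].
  eapply reach_trans; [apply H0|].
  eapply reach_step; [reflexivity|apply reach_refl].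
Qed.

Lemma evalPR_preach : forall p v y, evalPR p v y -> preach p v y.
Proof.
  (* Subderivations also occur under [Forall2] and inside the quantified premise of minimization, so
     the recursion is on the derivation itself. *)
  fix IH 4; intros p v y E; destruct E as
    [v | v | i v | f gs v ws y Hgs Hf | f g v y Hf | f g x v r y Hr Hg | f v n H0 Hm].
  - split; auto; intros; eapply reach_step; [apply mstep_zero | apply reach_refl].
  - split; auto; intros; eapply reach_step; [apply mstep_succ | apply reach_refl].
  - split; auto; intros; eapply reach_step; [apply mstep_proj | apply reach_refl].
  - apply (preach_comp f gs v ws y); [|apply IH, Hf].
    clear Hf; revert gs ws Hgs.
    fix IHl 3; intros gs ws Hgs; destruct Hgs as [|g w gs ws Hg Hgs]; constructor.
    + apply IH, Hg.
    + apply IHl, Hgs.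
  - apply preach_prec; intros X K _; apply IH, Hf.
  - apply preach_prec; intros X K L.
    apply IH in Hr; apply IH in Hg.
    eapply reach_trans; [apply Hr; lia|].
    eapply reach_step.
    { rewrite mstep_ret_prec.
      replace (x =? X) with false by (symmetry; apply Nat.eqb_neq; lia); reflexivity. }
    apply Hg.
  - apply preach_mu; [apply IH, H0|].
    intros m L; destruct (Hm m L) as [k Hk]; exists k; apply IH, Hk.
Qed.

Lemma haltsin_S n st : haltsin (S n) st = haltsin n (mstep st).
Proof. unfold haltsin; now rewrite Nat.iter_succ_r. Qed.

Lemma mstep_halted st : halted st = true -> mstep st = st.
Proof.
  destruct st as ([] & p & v & y & [|fr K]); unfold halted; simpl; try discriminate; auto.
Qed.

Lemma haltsin_mono n m st : n <= m -> haltsin n st = true -> haltsin m st = true.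
Proof.
  induction 1 as [|m L IH]; auto; intros E; specialize (IH E).
  unfold haltsin in *; simpl; now rewrite mstep_halted.
Qed.

(** A halting run must consume the frames [K], so it passes through a state that returns a value to
    [K]. The strict drop [m < n] makes strong induction on the number of steps possible. *)
Definition msound (n : nat) : Prop := forall p v K,
  haltsin n (eval_state (pcode p) v K) = true ->
  exists y m, m < n /\ evalPR p v y /\ haltsin m (ret_state y K) = true.

Lemma msound_comp n f v K (IH : forall m, m < n -> msound m) :
  forall rgs acc m, m < n -> haltsin m (mcomp (pcode f) (map pcode rgs) v acc K) = true ->
  exists rws m', m' <= m /\ Forall2 (fun g w => evalPR g v w) rgs rws /\
    haltsin m' (eval_state (pcode f) (rev rws ++ acc) K) = true.
Proof.
  induction rgs as [|g rgs IHr]; intros acc m L E.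
  - exists [], m; auto.
  - apply IH in E as (y & m1 & L1 & Hg & E); auto.
    destruct m1 as [|m1]; [discriminate|].
    rewrite haltsin_S in E.
    change (mstep _) with (mcomp (pcode f) (map pcode rgs) v (y :: acc) K) in E.
    apply IHr in E as (rws & m2 & L2 & HF & E); [|lia].
    exists (y :: rws), m2; repeat split; auto; [lia|].
    simpl; now rewrite <- app_assoc.
Qed.

Lemma msound_prec n f g v K (IH : forall m, m < n -> msound m) :
  forall d i r m, m < n -> evalPR (PRprec f g) (i :: v) r ->
  haltsin m (ret_state r ((1, (pcode g, ([], (v, [i; d + i])))) :: K)) = true ->
  exists y m', m' < m /\ evalPR (PRprec f g) (d + i :: v) y /\ haltsin m' (ret_state y K) = true.
Proof.
  induction d as [|d IHd]; intros i r m L Hr E; (destruct m as [|m]; [discriminate|]);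
    rewrite haltsin_S in E.
  - exists r, m; repeat split; auto.
    now rewrite mstep_ret_prec, Nat.eqb_refl in E.
  - rewrite mstep_ret_prec in E.
    replace (i =? S d + i) with false in E by (symmetry; apply Nat.eqb_neq; lia).
    apply IH in E as (y & m1 & L1 & Hg & E); [|lia].
    rewrite Nat.add_succ_comm in E |- *.
    apply IHd in E as (z & m2 & L2 & Hz & E); [|lia|eapply ev_precS; eauto].
    exists z, m2; repeat split; auto; lia.
Qed.

(** Nothing bounds the number of rounds in advance, so the induction is on the steps left, which
    decrease with each round. *)
Lemma msound_mu n f v K (IH : forall m, m < n -> msound m) :
  forall m i, m < n -> (forall j, j < i -> exists k, evalPR f (j :: v) (S k)) ->
  haltsin m (eval_state (pcode f) (i :: v) ((2, (pcode f, ([], (v, [i])))) :: K)) = true ->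
  exists y m', m' < m /\ evalPR (PRmu f) v y /\ haltsin m' (ret_state y K) = true.
Proof.
  induction m as [m IHm] using lt_wf_ind; intros i L Hi E.
  apply IH in E as (y & m1 & L1 & Hf & E); auto.
  destruct m1 as [|m1]; [discriminate|]; rewrite haltsin_S in E.
  destruct y as [|y].
  - exists i, m1; repeat split; [lia | now constructor | exact E].
  - apply (IHm m1) with (i := S i) in E as (z & m2 & L2 & Hz & E); try lia.
    + exists z, m2; repeat split; auto; lia.
    + intros j Lj; destruct (Nat.eq_dec j i); [subst; eauto | apply Hi; lia].
Qed.

Lemma msound_all n : msound n.
Proof.
  induction n as [n IH] using lt_wf_ind; intros p v K E.
  destruct n as [|n]; [discriminate|]; rewrite haltsin_S in E.
  destruct p as [| | i | f gs | f g | f].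
  - rewrite mstep_zero in E; exists 0, n; repeat split; auto; constructor.
  - rewrite mstep_succ in E; exists (S (hd 0 v)), n; repeat split; auto; constructor.
  - rewrite mstep_proj in E; exists (nth i v 0), n; repeat split; auto; constructor.
  - rewrite mstep_comp, <- map_rev in E.
    apply (msound_comp (S n)) in E as (rws & m & L & HF & E); auto.
    rewrite app_nil_r in E; apply IH in E as (y & m' & L' & Hf & E); [|lia].
    exists y, m'; repeat split; auto; [lia|].
    apply (ev_comp f gs v (rev rws)); auto.
    rewrite <- (rev_involutive gs); clear -HF; induction HF; simpl; auto using Forall2_app.
  - destruct v as [|x v].
    + rewrite mstep_prec_nil in E; exfalso; clear IH.
      induction n; [discriminate|]; rewrite haltsin_S, mstep_prec_nil in E; auto.
    + rewrite mstep_prec in E; apply IH in E as (r & m & L & Hf & E); auto.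
      rewrite <- (Nat.add_0_r x) in E.
      apply (msound_prec (S n) f) in E as (y & m' & L' & Hy & E); auto; [|now constructor].
      rewrite Nat.add_0_r in Hy; exists y, m'; repeat split; auto; lia.
  - rewrite mstep_mu in E.
    apply (msound_mu (S n)) in E as (y & m & L & Hy & E); auto; [|lia].
    exists y, m; repeat split; auto.
Qed.

Theorem halts_iff p v :
  (exists y, evalPR p v y) <-> exists n, haltsin n (eval_state (pcode p) v []) = true.
Proof.
  split.
  - intros [y E]; apply evalPR_preach in E as [E _]; destruct (E []) as [n En].
    exists n; unfold haltsin; now rewrite En.
  - intros [n E]; apply msound_all in E as (y & _ & _ & E & _); eauto.
Qed.

(** * The coloring *)

(* The elements in descending order, so that end segments of a set are prefixes of the list. *)
Definition bits (n : nat) : list nat :=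
  nat_rect (fun _ => list nat) [] (fun i l => if Nat.testbit n i then i :: l else l) n.

(* Only the first component of [e] is a program: each program has arbitrarily large indices. *)
Definition enumerates (e X s : nat) : bool := haltsin s (eval_state (fstn e) [X] []).

(** [Y] is compared with [T] followed by what remains of [Y] after [length T] entries; this is a
    mere equality of codes. *)
Definition prefixb (T Y : list nat) : bool := eqe (T ++ Nat.iter (length T) (@tl nat) Y) Y.

(* The target is compared with a residue modulo 7, so the value 7 stands for no target. *)
Definition record := (nat * (nat * (list nat * (list nat * (nat * nat)))))%type.
Definition prio (r : record) : nat := fst r.
Definition stage (r : record) : nat := fst (snd r).
Definition token (r : record) : list nat := fst (snd (snd r)).
Definition root (r : record) : list nat := fst (snd (snd (snd r))).
Definition target (r : record) : nat := fst (snd (snd (snd (snd r)))).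
Definition event (r : record) : nat := snd (snd (snd (snd (snd r)))).
Definition null_record : record := (0, (0, ([], ([], (7, 0))))).

(** The default [null_record] has event 0, so it triggers nothing. On the stacks that arise at most
    one token fits, see [lookup_unique]. *)
Definition lookup (h : list record) (Y : list nat) : record :=
  fold_right (fun r acc => if prefixb (token r) Y then r else acc) null_record h.

Fixpoint event_sum (H : nat -> list record) (l : list nat) : nat :=
  match l with
  | [] => 0
  | x :: l' => event_sum H l' + event (lookup (H x) l')
  end.

(** The state holds the target of the last token met and the event sum since then. At a restart the
    event of the token itself is not added. A set that meets no token keeps the initial target 7 and
    has color 1. *)
Definition scan_step (h : list record) (Y : list nat) (st : nat * nat) : nat * nat :=
  if eqe (token (lookup h Y)) Y then (target (lookup h Y), 0)
  else (fst st, snd st + event (lookup h Y)).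

Fixpoint scan (H : nat -> list record) (l : list nat) : nat * nat :=
  match l with
  | [] => (7, 0)
  | x :: l' => scan_step (H x) l' (scan H l')
  end.

(** Smaller numbers are higher priorities: the records removed are those injured by an action of
    requirement [e]. *)
Definition pop (e : nat) (h : list record) : list record :=
  Nat.iter (length h) (fun h => if e <? prio (hd null_record h) then tl h else h) h.

(** For [y < 7], both [shift y] and [y + shift y] modulo 7 lie in {1, 2, 4}. These are the nonzero
    squares modulo 7, and -1 is not a square, so two of them never add up to 0. *)
Definition shift (y : nat) : nat := nth y [1; 1; 2; 1; 4; 4; 2] 0.

(** [1 <= e] separates requirements from [null_record], whose priority is 0. The lower bound on the
    elements puts [X] beyond all surviving tokens and beyond every set of numbers below [e]. The
    last test stops a requirement whose token with target 0 exists. *)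
Definition eligible (h : list record) (s e X : nat) : bool :=
  (1 <=? e) && enumerates e X s && negb (X =? 0) &&
  forallb (fun x => Nat.max e (stage (hd null_record (pop e h))) <=? x) (bits X) &&
  (if prio (hd null_record (pop e h)) =? e then 1 <=? target (hd null_record (pop e h)) else true).

(** The root has target 7 and each further token lowers the target by one, down to 0. The event
    makes event sum, target and event of the token add up to a member of {1, 2, 4} modulo 7. *)
Definition new_record (H : nat -> list record) (e : nat) (r : record) (t : list nat) (s : nat) :
    record :=
  if prio r =? e then
    (e, (S s, (t ++ root r, (root r,
       (Nat.pred (target r), shift ((event_sum H (t ++ root r) + Nat.pred (target r)) mod 7))))))
  else (e, (S s, (t, (t, (7, 0))))).

Definition past_stack (K : list (list record)) (x : nat) : list record := nth (length K - S x) K [].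

(** A search result equal to its bound [s] means that nothing is eligible; otherwise the requirement
    of highest priority acts. *)
Definition next_stack (s : nat) (K : list (list record)) : list record :=
  let e := first_below (fun e => first_below (eligible (hd [] K) s e) s <? s) s in
  if e =? s then hd [] K
  else new_record (past_stack K) e (hd null_record (pop e (hd [] K)))
         (bits (first_below (eligible (hd [] K) s e) s)) s
         :: pop e (hd [] K).

(** A course-of-values recursion, newest stack first: the event of a new token depends on the stacks
    at the stages that are its elements. *)
Definition history (s : nat) : list (list record) :=
  nat_rect (fun _ => list (list record)) [[]] (fun s K => next_stack s K :: K) s.

Definition stack (s : nat) : list record := hd [] (history s).

(* [false] is the color 0. *)
Definition coloring (n : nat) : bool :=
  negb (fst (scan stack (bits n)) =? snd (scan stack (bits n)) mod 7).

(** * Computability of the coloring *)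

Lemma cmp_enumerates {G} `{Enc G} (e X s : G -> nat) :
  Cmp e -> Cmp X -> Cmp s -> Cmp (fun g => enumerates (e g) (X g) (s g)).
Proof.
  intros He HX Hs; unfold enumerates.
  apply (cmp_haltsin s (fun g => eval_state (fstn (e g)) [X g] [])); auto.
  unfold eval_state; cmp.
  apply (cmp_ext (fun g => fst (decp (e g)))); [reflexivity|]; cmp.
Qed.

Lemma cmp_bits {G} `{Enc G} (n : G -> nat) : Cmp n -> Cmp (fun g => bits (n g)).
Proof. intros; unfold bits; cmp. Qed.

Lemma cmp_lookup {G} `{Enc G} (h : G -> list record) (Y : G -> list nat) :
  Cmp h -> Cmp Y -> Cmp (fun g => lookup (h g) (Y g)).
Proof.
  intros; unfold lookup, prefixb, token; cmp.
Qed.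

Lemma cmp_pop {G} `{Enc G} (e : G -> nat) (h : G -> list record) :
  Cmp e -> Cmp h -> Cmp (fun g => pop (e g) (h g)).
Proof. intros; unfold pop, prio; cmp. Qed.

Ltac cmp_user ::=
  match goal with
  | |- Cmp (fun x => enumerates (@?e x) (@?f x) (@?g x)) => apply (cmp_enumerates e f g)
  | |- Cmp (fun x => bits (@?f x)) => apply (cmp_bits f)
  | |- Cmp (fun x => lookup (@?f x) (@?g x)) => apply (cmp_lookup f g)
  | |- Cmp (fun x => pop (@?f x) (@?g x)) => apply (cmp_pop f g)
  end.

Lemma cmp_event_sum {G} `{Enc G} (J : G -> nat -> list record) (l : G -> list nat) :
  Cmp (fun q : G * nat => J (fst q) (snd q)) -> Cmp l -> Cmp (fun g => event_sum (J g) (l g)).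
Proof.
  intros HH Hl.
  apply (cmp_ext (fun g => snd (fold_right
    (fun x acc => (x :: fst acc, snd acc + event (lookup (J g x) (fst acc)))) ([], 0) (l g)))).
  - intros g; transitivity (snd (l g, event_sum (J g) (l g))); [f_equal | reflexivity].
    induction (l g) as [|x m IH]; simpl; [|rewrite IH]; reflexivity.
  - unfold event; cmp.
Qed.

Lemma cmp_scan {G} `{Enc G} (J : G -> nat -> list record) (l : G -> list nat) :
  Cmp (fun q : G * nat => J (fst q) (snd q)) -> Cmp l -> Cmp (fun g => scan (J g) (l g)).
Proof.
  intros HH Hl.
  apply (cmp_ext (fun g => snd (fold_right
    (fun x acc => (x :: fst acc, scan_step (J g x) (fst acc) (snd acc))) ([], (7, 0)) (l g)))).
  - intros g; transitivity (snd (l g, scan (J g) (l g))); [f_equal | reflexivity].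
    induction (l g) as [|x m IH]; simpl; [|rewrite IH]; reflexivity.
  - unfold scan_step, token, target, event; cmp.
Qed.

Lemma cmp_eligible {G} `{Enc G} (h : G -> list record) (s e X : G -> nat) :
  Cmp h -> Cmp s -> Cmp e -> Cmp X -> Cmp (fun g => eligible (h g) (s g) (e g) (X g)).
Proof. intros; unfold eligible, stage, prio, target; cmp. Qed.

Lemma cmp_past_stack {G} `{Enc G} (K : G -> list (list record)) (x : G -> nat) :
  Cmp K -> Cmp x -> Cmp (fun g => past_stack (K g) (x g)).
Proof. intros; unfold past_stack; cmp. Qed.

Ltac cmp_user ::=
  match goal with
  | |- Cmp (fun x => enumerates (@?e x) (@?f x) (@?g x)) => apply (cmp_enumerates e f g)
  | |- Cmp (fun x => bits (@?f x)) => apply (cmp_bits f)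
  | |- Cmp (fun x => lookup (@?f x) (@?g x)) => apply (cmp_lookup f g)
  | |- Cmp (fun x => pop (@?f x) (@?g x)) => apply (cmp_pop f g)
  | |- Cmp (fun x => event_sum (@?f x) (@?g x)) => apply (cmp_event_sum f g)
  | |- Cmp (fun x => scan (@?f x) (@?g x)) => apply (cmp_scan f g)
  | |- Cmp (fun x => eligible (@?h x) (@?s x) (@?e x) (@?X x)) => apply (cmp_eligible h s e X)
  | |- Cmp (fun x => past_stack (@?f x) (@?g x)) => apply (cmp_past_stack f g)
  end.

Lemma cmp_new_record {G} `{Enc G} (K : G -> list (list record)) (e s : G -> nat) (r : G -> record)
    (t : G -> list nat) :
  Cmp K -> Cmp e -> Cmp r -> Cmp t -> Cmp s ->
  Cmp (fun g => new_record (past_stack (K g)) (e g) (r g) (t g) (s g)).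
Proof. intros; unfold new_record, shift, root, target, prio; cmp. Qed.

Lemma cmp_next_stack {G} `{Enc G} (s : G -> nat) (K : G -> list (list record)) :
  Cmp s -> Cmp K -> Cmp (fun g => next_stack (s g) (K g)).
Proof.
  intros Hs HK; unfold next_stack.
  assert (He : Cmp (fun g =>
      first_below (fun e => first_below (eligible (hd [] (K g)) (s g) e) (s g) <? s g) (s g)))
    by cmp.
  set (e := fun g =>
    first_below (fun e => first_below (eligible (hd [] (K g)) (s g) e) (s g) <? s g) (s g)) in *.
  apply (cmp_if (fun g => e g =? s g) (fun g => hd [] (K g))
    (fun g => new_record (past_stack (K g)) (e g) (hd null_record (pop (e g) (hd [] (K g))))
       (bits (first_below (eligible (hd [] (K g)) (s g) (e g)) (s g))) (s g)
         :: pop (e g) (hd [] (K g))));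
    clearbody e; [cmp | cmp | apply cmp_cons; [|cmp]].
  apply (cmp_new_record K e s (fun g => hd null_record (pop (e g) (hd [] (K g))))
    (fun g => bits (first_below (eligible (hd [] (K g)) (s g) (e g)) (s g)))); cmp.
Qed.

Lemma cmp_coloring : Cmp coloring.
Proof.
  assert (HK : Cmp history).
  { unfold history.
    apply (cmp_nat_rect (G := nat) (fun _ => [[]]) (fun _ s K => next_stack s K :: K)
             (fun n => n)); cmp.
    apply (cmp_next_stack (fun q : nat * (nat * list (list record)) => fst (snd q))
             (fun q => snd (snd q))); cmp. }
  assert (HH : Cmp stack) by (apply (cmp_hd [] history); auto).
  assert (HH2 : Cmp (fun q : nat * nat => stack (snd q))) by (apply (cmp_comp stack); cmp).
  unfold coloring; cmp.
Qed.

Lemma computable_Cmp (c : nat -> bool) : Cmp c -> computable_bool c.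
Proof.
  intros (F & [p Hp] & E); exists p; intros n.
  pose proof (E n) as En; simpl in En; rewrite <- En; apply Hp.
Qed.

(** * Sets as descending lists, and the stages *)

Definition bits_upto (n k : nat) : list nat :=
  nat_rect (fun _ => list nat) [] (fun i l => if Nat.testbit n i then i :: l else l) k.

Lemma in_bits_upto n k i : In i (bits_upto n k) <-> i < k /\ Nat.testbit n i = true.
Proof.
  induction k as [|k IH]; simpl; [lia|].
  change (nat_rect _ _ _ k) with (bits_upto n k).
  destruct (Nat.testbit n k) eqn:E; simpl; rewrite IH; split.
  - intros [<- | [L T]]; auto with arith.
  - intros [L T]; destruct (Nat.eq_dec i k); [left; auto | right; split; auto; lia].
  - intros [L T]; split; auto.
  - intros [L T]; split; auto; destruct (Nat.eq_dec i k); [congruence | lia].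
Qed.

Lemma in_bits n i : In i (bits n) <-> Nat.testbit n i = true.
Proof.
  unfold bits; change (nat_rect _ _ _ n) with (bits_upto n n); rewrite in_bits_upto.
  split; [tauto|]; intros T; split; auto.
  destruct (Nat.lt_ge_cases i n) as [L | L]; auto.
  rewrite Nat.bits_above_log2 in T; [discriminate|].
  destruct n; [simpl in T; now rewrite Nat.bits_0 in T|].
  pose proof (Nat.log2_lt_lin (S n)); lia.
Qed.

Lemma bits_lt X i : In i (bits X) -> i < X.
Proof.
  unfold bits; change (nat_rect _ _ _ X) with (bits_upto X X); rewrite in_bits_upto; tauto.
Qed.

Definition desc : list nat -> Prop := StronglySorted (fun a b => b < a).

Lemma desc_bits n : desc (bits n).
Proof.
  unfold bits; generalize n at 2; intros k; induction k as [|k IH]; simpl; [constructor|].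
  destruct (Nat.testbit n k); auto; constructor; auto.
  apply Forall_forall; intros x Hx; apply (in_bits_upto n k) in Hx; tauto.
Qed.

Lemma desc_ext l m : desc l -> desc m -> (forall i, In i l <-> In i m) -> l = m.
Proof.
  intros Hl; revert m; induction Hl as [|a l Hl IH Ha]; intros m Hm E.
  - destruct m as [|b m]; auto; exfalso; apply (E b); simpl; auto.
  - destruct Hm as [|b m Hm Hb]; [exfalso; apply (E a); simpl; auto|].
    rewrite Forall_forall in Ha, Hb.
    assert (a = b).
    { destruct (proj1 (E a) (or_introl eq_refl)) as [|I1]; auto.
      destruct (proj2 (E b) (or_introl eq_refl)) as [|I2]; auto.
      apply Hb in I1; apply Ha in I2; lia. }
    subst b; f_equal; apply IH; auto; intros i; split; intros I.
    + destruct (proj1 (E i) (or_intror I)) as [<-|]; auto; apply Ha in I; lia.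
    + destruct (proj2 (E i) (or_intror I)) as [<-|]; auto; apply Hb in I; lia.
Qed.

Lemma desc_app l m : desc l -> desc m -> (forall x y, In x l -> In y m -> y < x) -> desc (l ++ m).
Proof.
  intros Hl Hm; induction Hl as [|a l Hl IH Ha]; intros E; simpl; auto.
  constructor.
  - apply IH; intros; apply E; simpl; auto.
  - rewrite Forall_forall in *; intros x Hx; apply in_app_iff in Hx as [Hx | Hx]; auto.
    apply E; simpl; auto.
Qed.

Lemma bits_lor a b :
  (forall x y, In x (bits a) -> In y (bits b) -> x < y) ->
  bits (Nat.lor a b) = bits b ++ bits a.
Proof.
  intros L; apply desc_ext.
  - apply desc_bits.
  - apply desc_app; auto using desc_bits.
  - intros i; rewrite in_app_iff, !in_bits, Nat.lor_spec, orb_true_iff; tauto.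
Qed.

Lemma bits_nonempty n : n <> 0 -> bits n <> [].
Proof.
  intros N E; apply N, Nat.bits_inj_0; intros i.
  destruct (Nat.testbit n i) eqn:T; auto.
  apply in_bits in T; now rewrite E in T.
Qed.

Definition prefix (T Y : list nat) : Prop := exists D, Y = T ++ D.

Lemma iter_tl_app (T D : list nat) : Nat.iter (length T) (@tl nat) (T ++ D) = D.
Proof.
  induction T as [|a T IH]; auto; simpl length; rewrite Nat.iter_succ_r; apply IH.
Qed.

Lemma prefixb_spec T Y : prefixb T Y = true <-> prefix T Y.
Proof.
  unfold prefixb; rewrite eqe_spec; split.
  - intros E; eexists; eauto.
  - intros [D ->]; now rewrite iter_tl_app.
Qed.

Lemma prefixb_hd T Y : T <> [] -> prefixb T Y = true -> Y <> [] /\ hd 0 T = hd 0 Y.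
Proof.
  intros N; rewrite prefixb_spec; intros [D ->]; destruct T; simpl; split; congruence.
Qed.

Lemma lookup_In h Y :
  lookup h Y = null_record \/ In (lookup h Y) h /\ prefix (token (lookup h Y)) Y.
Proof.
  induction h as [|r h IH]; simpl; auto.
  destruct (prefixb (token r) Y) eqn:E.
  - right; split; auto; now apply prefixb_spec.
  - fold (lookup h Y); tauto.
Qed.

Lemma lookup_app_r A P Y :
  (forall a, In a A -> prefixb (token a) Y = false) -> lookup (A ++ P) Y = lookup P Y.
Proof.
  induction A as [|a A IH]; intros E; simpl; auto.
  rewrite E by (simpl; auto); apply IH; intros; apply E; simpl; auto.
Qed.

Lemma lookup_app_l A P Y :
  (forall a, In a P -> prefixb (token a) Y = false) -> lookup (A ++ P) Y = lookup A Y.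
Proof.
  intros E; induction A as [|a A IH]; simpl.
  - rewrite <- (app_nil_r P), lookup_app_r; auto.
  - now rewrite <- IH.
Qed.

Lemma lookup_ext A Y Y' :
  (forall a, In a A -> prefixb (token a) Y = prefixb (token a) Y') -> lookup A Y = lookup A Y'.
Proof.
  induction A as [|a A IH]; intros E; simpl; auto.
  fold (lookup A Y); fold (lookup A Y'); rewrite E by (simpl; auto); rewrite IH; auto.
  intros; apply E; simpl; auto.
Qed.

Lemma prefixb_app n T l b :
  (forall x, In x T -> n <= x) -> (forall x, In x b -> x < n) ->
  prefixb T (l ++ b) = prefixb T l.
Proof.
  intros HT Hb; apply eq_true_iff_eq; rewrite !prefixb_spec; split.
  - intros [D E]; revert T HT E; induction l as [|a l IH]; intros [|t T] HT E.
    + now exists [].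
    + exfalso; simpl in E; subst b; specialize (HT t (or_introl eq_refl));
        specialize (Hb t (or_introl eq_refl)); lia.
    + eexists; reflexivity.
    + injection E as -> E; destruct (IH T) as [D' ->]; auto.
      { intros; apply HT; simpl; auto. }
      eexists; reflexivity.
  - intros [D ->]; exists (D ++ b); now rewrite app_assoc.
Qed.

Lemma pop_nil e : pop e [] = [].
Proof. reflexivity. Qed.

Lemma pop_stop e r h : prio r <= e -> pop e (r :: h) = r :: h.
Proof.
  intros L; unfold pop; induction (length (r :: h)); auto.
  simpl; rewrite IHn; simpl.
  destruct (Nat.ltb_spec e (prio r)); auto; lia.
Qed.

Lemma pop_skip e r h : e < prio r -> pop e (r :: h) = pop e h.
Proof.
  intros L; unfold pop; simpl length; rewrite Nat.iter_succ_r; simpl hd.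
  destruct (Nat.ltb_spec e (prio r)); auto; lia.
Qed.

Lemma pop_spec e h :
  exists B, h = B ++ pop e h /\ (forall b, In b B -> e < prio b) /\
    (pop e h = [] \/ prio (hd null_record (pop e h)) <= e).
Proof.
  induction h as [|r h (B & E & HB & Hh)].
  - exists []; rewrite pop_nil; simpl; tauto.
  - destruct (Nat.le_gt_cases (prio r) e).
    + exists []; rewrite pop_stop; simpl; tauto.
    + rewrite pop_skip by auto; exists (r :: B); repeat split; auto.
      * simpl; congruence.
      * intros b [<- | I]; auto.
Qed.

Lemma pop_app e A h :
  (forall a, In a A -> e < prio a) -> (h = [] \/ prio (hd null_record h) <= e) ->
  pop e (A ++ h) = h.
Proof.
  intros HA Hh; induction A as [|a A IH]; simpl.
  - destruct h as [|r h]; auto; apply pop_stop; destruct Hh; auto; discriminate.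
  - rewrite pop_skip by (apply HA; simpl; auto); apply IH; intros; apply HA; simpl; auto.
Qed.

Lemma history_length s : length (history s) = S s.
Proof. induction s; simpl; auto. Qed.

Lemma history_S s : history (S s) = next_stack s (history s) :: history s.
Proof. reflexivity. Qed.

Lemma past_stack_history s x : x <= s -> past_stack (history s) x = stack x.
Proof.
  induction s as [|s IH]; intros L.
  - now replace x with 0 by lia.
  - destruct (Nat.eq_dec x (S s)) as [-> | N].
    + unfold past_stack; rewrite history_length, Nat.sub_diag; reflexivity.
    + rewrite <- IH by lia; unfold past_stack.
      rewrite history_S; simpl length; rewrite history_length.
      now replace (S (S s) - S x) with (S (S s - S x)) by lia.
Qed.

Lemma event_sum_ext H H' l : (forall x, In x l -> H x = H' x) -> event_sum H l = event_sum H' l.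
Proof.
  induction l as [|a l IH]; intros E; simpl; auto.
  rewrite E by (simpl; auto); rewrite IH; auto.
  intros; apply E; simpl; auto.
Qed.

Definition top_record (e s : nat) : record := hd null_record (pop e (stack s)).

Definition act (s e X : nat) : Prop :=
  e < s /\ X < s /\ eligible (stack s) s e X = true /\
  stack (S s) =
  new_record (past_stack (history s)) e (top_record e s) (bits X) s :: pop e (stack s).

Lemma step_spec s :
  (stack (S s) = stack s /\ forall e X, e < s -> X < s -> eligible (stack s) s e X = false) \/
  exists e X, act s e X /\ forall e' X', e' < e -> X' < s -> eligible (stack s) s e' X' = false.
Proof.
  assert (E : stack (S s) = next_stack s (history s)) by reflexivity.
  unfold next_stack in E; fold (stack s) in E.
  set (P := fun e => first_below (eligible (stack s) s e) s <? s) in E.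
  assert (HP : forall e, P e = false -> forall X, X < s -> eligible (stack s) s e X = false).
  { intros e; unfold P; rewrite Nat.ltb_ge; intros L X LX.
    apply (first_below_spec (eligible (stack s) s e) s); lia. }
  destruct (first_below_spec P s) as (L & Pe & Pm).
  destruct (Nat.eqb_spec (first_below P s) s) as [N | N].
  - left; split; auto; intros e X Le LX; apply HP; auto; apply Pm; lia.
  - right; exists (first_below P s), (first_below (eligible (stack s) s (first_below P s)) s).
    assert (Lt : first_below P s < s) by lia.
    specialize (Pe Lt); unfold P in Pe at 1; apply Nat.ltb_lt in Pe.
    split; [|intros e' X' L1 L2; apply HP; auto].
    repeat split; auto.
    now apply (first_below_spec (eligible (stack s) s (first_below P s)) s).
Qed.

Lemma eligible_spec h s e X :
  eligible h s e X = true <->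
  1 <= e /\ enumerates e X s = true /\ X <> 0 /\
  (forall x, In x (bits X) -> Nat.max e (stage (hd null_record (pop e h))) <= x) /\
  (prio (hd null_record (pop e h)) = e -> 1 <= target (hd null_record (pop e h))).
Proof.
  unfold eligible; rewrite !andb_true_iff, negb_true_iff, Nat.leb_le, Nat.eqb_neq, forallb_forall.
  setoid_rewrite Nat.leb_le.
  destruct (Nat.eqb_spec (prio (hd null_record (pop e h))) e); rewrite ?Nat.leb_le; tauto.
Qed.

(** * Invariants of the stack *)

Definition fresh (e : nat) (t : list nat) : Prop :=
  exists X s, t = bits X /\ X <> 0 /\ enumerates e X s = true.

(** The invariant of all stacks. Events refer here to the global [stack] instead of a finite
    history, and the condition that [scan] yields 7 says that a token other than a root has color
    1. *)
Inductive wf : list record -> Prop :=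
| wf_nil : wf []
| wf_new e m t h :
    wf h -> 1 <= e -> prio (hd null_record h) < e -> stage (hd null_record h) < m -> fresh e t ->
    (forall x, In x t -> Nat.max e (stage (hd null_record h)) <= x < m) ->
    wf ((e, (m, (t, (t, (7, 0))))) :: h)
| wf_more e m t h :
    wf h -> 1 <= e -> prio (hd null_record h) = e -> stage (hd null_record h) < m -> fresh e t ->
    (forall x, In x t -> Nat.max e (stage (hd null_record h)) <= x < m) ->
    1 <= target (hd null_record h) -> fst (scan stack (t ++ root (hd null_record h))) = 7 ->
    wf ((e, (m, (t ++ root (hd null_record h), (root (hd null_record h),
          (Nat.pred (target (hd null_record h)),
           shift ((event_sum stack (t ++ root (hd null_record h)) +
                   Nat.pred (target (hd null_record h))) mod 7)))))) :: h).

Lemma fresh_nonempty e t : fresh e t -> t <> [].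
Proof. intros (X & s & -> & N & _); now apply bits_nonempty. Qed.

Lemma wf_app_r A h : wf (A ++ h) -> wf h.
Proof. induction A as [|a A IH]; simpl; auto; intros W; inversion W; auto. Qed.

Lemma hd_In (h : list record) :
  1 <= prio (hd null_record h) -> exists h', h = hd null_record h :: h'.
Proof. destruct h as [|r h]; simpl; [lia | eauto]. Qed.

Ltac proj := cbn [prio stage token root target event fst snd hd] in *.

Lemma wf_basic h : wf h -> forall r, In r h ->
  token r <> [] /\ (forall x, In x (token r) \/ In x (root r) -> prio r <= x < stage r) /\
  1 <= prio r /\ prio r <= prio (hd null_record h) /\ stage r <= stage (hd null_record h).
Proof.
  induction 1 as [|e m t h W IH L1 Li Lt F R|e m t h W IH L1 Li Lt F R M S]; intros r I.
  - destruct I.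
  - pose proof (fresh_nonempty _ _ F).
    destruct I as [<- | I]; proj.
    + repeat split; auto; destruct H0 as [I | I]; apply R in I; lia.
    + destruct (IH r I) as (I1 & I2 & I3 & I4 & I5); repeat split; auto; try lia; apply I2; auto.
  - pose proof (fresh_nonempty _ _ F).
    destruct I as [<- | I]; proj.
    + assert (Hx : forall x, In x (root (hd null_record h)) -> e <= x < m).
      { intros x Ix; destruct (hd_In h) as [h' E]; [lia|].
        destruct (IH (hd null_record h)) as (_ & I2 & _); [rewrite E at 2; simpl; auto|].
        specialize (I2 x (or_intror Ix)); lia. }
      repeat split; auto.
      * destruct t; [congruence | discriminate].
      * destruct H0 as [I | I]; [apply in_app_iff in I as [I | I]; [apply R in I; lia|]|];
          now apply Hx.
      * destruct H0 as [I | I]; [apply in_app_iff in I as [I | I]; [apply R in I; lia|]|];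
          now apply Hx.
    + destruct (IH r I) as (I1 & I2 & I3 & I4 & I5); repeat split; auto; try lia; apply I2; auto.
Qed.

(** The head of a token is its maximum and belongs to the set added last, which lies beyond the
    stage of the record underneath. The rest of the token may be a root older than [r], so only the
    head is bounded. *)
Lemma wf_order A r h : wf (A ++ r :: h) -> forall a, In a A -> stage r <= hd 0 (token a).
Proof.
  induction A as [|b A IH]; intros W a I; [destruct I|].
  destruct I as [-> | I]; [|apply IH; auto; inversion W; auto].
  assert (W' : wf (A ++ r :: h)) by (inversion W; auto).
  assert (stage r <= stage (hd null_record (A ++ r :: h))) by (apply (wf_basic _ W'); apply in_elt).
  simpl in W; inversion W as [|e m t h' W1 L1 Li Lt F R E|e m t h' W1 L1 Li Lt F R M S E]; proj.
  - apply fresh_nonempty in F; destruct t as [|x t]; [congruence|].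
    specialize (R x (or_introl eq_refl)); simpl; lia.
  - apply fresh_nonempty in F; destruct t as [|x t]; [congruence|].
    specialize (R x (or_introl eq_refl)); simpl; lia.
Qed.

(** A strictly larger priority number excludes a root shared with [r]; hence, unlike in [wf_order],
    the whole token lies beyond [stage r]. *)
Lemma wf_above A r h : wf (A ++ r :: h) -> (forall a, In a A -> prio r < prio a) ->
  forall a, In a A -> forall x, In x (token a) \/ In x (root a) -> stage r <= x.
Proof.
  induction A as [|b A IH]; intros W L a I; [destruct I|].
  assert (W' : wf (A ++ r :: h)) by (inversion W; auto).
  assert (L' : forall a, In a A -> prio r < prio a) by (intros; apply L; simpl; auto).
  destruct I as [-> | I]; [|now apply IH].
  assert (T : stage r <= stage (hd null_record (A ++ r :: h))).
  { apply (wf_basic _ W'), in_elt. }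
  specialize (L a (or_introl eq_refl)).
  simpl in W.
  inversion W as [|e m t h' W1 L1 Li Lt F R E|e m t h' W1 L1 Li Lt F R M S E]; subst a; proj.
  - intros x [I | I]; apply R in I; lia.
  - assert (Hx : forall x, In x (root (hd null_record (A ++ r :: h))) -> stage r <= x).
    { destruct A as [|b A]; [simpl in Li; lia|].
      intros x Ix; apply (IH W' L' b); simpl; auto. }
    intros x [I | I]; auto; apply in_app_iff in I as [I | I]; auto; apply R in I; lia.
Qed.

Lemma wf_kind h : wf h -> forall r, In r h ->
  (target r = 7 /\ event r = 0) \/
  (target r < 7 /\ fst (scan stack (token r)) = 7 /\
   event r = shift ((event_sum stack (token r) + target r) mod 7)).
Proof.
  induction 1 as [|e m t h W IH L1 Li Lt F R|e m t h W IH L1 Li Lt F R M S]; intros r I.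
  - destruct I.
  - destruct I as [<- | I]; auto.
  - destruct I as [<- | I]; auto; right; proj; repeat split; auto.
    destruct (hd_In h) as [h' E]; [lia|].
    destruct (IH (hd null_record h)) as [[] | []]; [rewrite E at 2; simpl; auto| |]; lia.
Qed.

Lemma wf_token h : wf h -> forall r, In r h ->
  fresh (prio r) (root r) /\
  (token r = root r \/ exists t, fresh (prio r) t /\ token r = t ++ root r /\
     forall x y, In x (root r) -> In y t -> x < y).
Proof.
  induction 1 as [|e m t h W IH L1 Li Lt F R|e m t h W IH L1 Li Lt F R M S]; intros r I.
  - destruct I.
  - destruct I as [<- | I]; auto.
  - destruct I as [<- | I]; auto.
    destruct (hd_In h) as [h' E]; [lia|].
    assert (I : In (hd null_record h) h) by (rewrite E at 2; simpl; auto).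
    destruct (IH _ I) as [F' _]; rewrite Li in F'; split; auto.
    right; exists t; repeat split; auto; proj; intros x y Hx Hy.
    apply R in Hy; destruct (wf_basic _ W _ I) as (_ & B & _).
    specialize (B x (or_intror Hx)); lia.
Qed.

(** The record of a root stays underneath all records built on it. Thus a scan that passes a root
    restarts with target 7. *)
Lemma wf_root h : wf h -> forall r, In r h ->
  exists r', In r' h /\ token r' = root r /\ target r' = 7.
Proof.
  induction 1 as [|e m t h W IH L1 Li Lt F R|e m t h W IH L1 Li Lt F R M S]; intros r I.
  - destruct I.
  - destruct I as [<- | I]; [eexists; split; [left; reflexivity | auto]|].
    destruct (IH r I) as (r' & I' & E); exists r'; simpl; auto.
  - assert (K : exists r'', In r'' h /\ root r = root r'').
    { destruct I as [<- | I]; [|eauto].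
      exists (hd null_record h); split; auto.
      destruct (hd_In h) as [h' E]; [lia | rewrite E at 2; simpl; auto]. }
    destruct K as (r'' & I'' & ->); destruct (IH r'' I'') as (r' & I' & E).
    exists r'; simpl; auto.
Qed.

(** Within one requirement the target falls from 7 in steps of one, so no value is skipped. *)
Lemma wf_chain h : wf h -> h <> [] -> forall b, target (hd null_record h) <= b <= 7 ->
  exists r, In r h /\ prio r = prio (hd null_record h) /\ target r = b.
Proof.
  induction 1 as [|e m t h W IH L1 Li Lt F R|e m t h W IH L1 Li Lt F R M S]; intros N b Hb.
  - congruence.
  - eexists; repeat split; [left; reflexivity|]; proj; lia.
  - destruct (Nat.eq_dec b (Nat.pred (target (hd null_record h)))) as [-> | Nb].
    + refine (ex_intro _ _ (conj (or_introl eq_refl) (conj eq_refl eq_refl))).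
    + proj; destruct IH with (b := b) as (r & I1 & I2 & I3); [|lia|].
      * intros ->; simpl in Li; lia.
      * exists r; repeat split; simpl; auto; lia.
Qed.

(** A token further up has maximum at least [stage r], whereas the maximum of [Y] is that of
    [token r] and so is smaller. The search thus reaches [r]. *)
Lemma lookup_unique h r Y : wf h -> In r h -> prefix (token r) Y -> lookup h Y = r.
Proof.
  intros W I HP; apply in_split in I as (A & B & ->).
  destruct (wf_basic _ W r (in_elt _ _ _)) as (N & R & _).
  rewrite lookup_app_r.
  - simpl; now rewrite (proj2 (prefixb_spec _ _) HP).
  - intros a Ia; apply not_true_is_false; intros E.
    pose proof (wf_order _ _ _ W a Ia) as O.
    apply prefixb_spec, prefixb_hd in HP; auto; destruct HP as [_ HP].
    destruct (wf_basic _ W a) as (Na & _); [apply in_app_iff; auto|].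
    apply prefixb_hd in E as [_ E]; auto.
    destruct (token r) as [|x t] eqn:Er; [congruence|].
    specialize (R x (or_introl (or_introl eq_refl))); simpl in HP; lia.
Qed.

Lemma prio_new_record H e r t s : prio (new_record H e r t s) = e.
Proof. unfold new_record; destruct (prio r =? e); reflexivity. Qed.
Lemma stage_new_record H e r t s : stage (new_record H e r t s) = S s.
Proof. unfold new_record; destruct (prio r =? e); reflexivity. Qed.

Lemma stack_cases s : stack (S s) = stack s \/ exists e X, act s e X.
Proof. destruct (step_spec s) as [[] | (e & X & A & _)]; eauto. Qed.

(** Backwards in time: a step pushes one record, stamped with the new stage, and what it pops has a
    larger priority number than the requirement that acts. So [r] and all beneath it were in place
    from [stage r] on. *)
Lemma persist s : forall A r h, stack s = A ++ r :: h -> (forall a, In a A -> prio r < prio a) ->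
  forall x, stage r <= x <= s ->
  exists A', stack x = A' ++ r :: h /\ forall a, In a A' -> prio r < prio a.
Proof.
  induction s as [|s IH]; intros A r h E L x Hx.
  - exists A; now replace x with 0 by lia.
  - destruct (Nat.eq_dec x (S s)) as [-> | N]; [eauto|].
    destruct (stack_cases s) as [E' | (e & X & _ & _ & _ & E')]; rewrite E' in E.
    + eapply IH; eauto; lia.
    + destruct A as [|a A]; simpl in E; injection E as E1 E2.
      * apply (f_equal stage) in E1; rewrite stage_new_record in E1; lia.
      * destruct (pop_spec e (stack s)) as (B & EB & HB & _).
        rewrite E2, app_assoc in EB.
        apply (IH _ _ _ EB); [|lia].
        assert (prio r < e).
        { specialize (L a (or_introl eq_refl)); rewrite <- E1, prio_new_record in L; auto. }
        intros b I; apply in_app_iff in I as [I | I]; [apply HB in I; lia | apply L; simpl; auto].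
Qed.

(** With [below] this describes a cut at [n]: at the stages in [u] the stack extends a fixed [P],
    the tokens of [P] lie below [n] and all others lie above. No token in force then straddles the
    cut. *)
Definition above (n : nat) (P : list record) (u : list nat) : Prop :=
  forall x, In x u -> n <= x /\ exists Q, stack x = Q ++ P /\
    forall a, In a Q -> token a <> [] /\ forall y, In y (token a) -> n <= y.

Definition below (n : nat) (P : list record) (b : list nat) : Prop :=
  (forall a, In a P -> token a <> [] /\ forall y, In y (token a) -> y < n) /\
  forall x, In x b -> x < n.

Lemma hd_in (T : list nat) : T <> [] -> In (hd 0 T) T.
Proof. destruct T; [congruence | simpl; auto]. Qed.

Lemma lookup_first n P y b : above n P [y] -> below n P b -> lookup (stack y) b = lookup P b.
Proof.
  intros U [BP Bb]; destruct (U y (or_introl eq_refl)) as (_ & Q & -> & HQ).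
  apply lookup_app_r; intros a I; apply not_true_is_false; intros E.
  destruct (HQ a I) as [N La]; apply prefixb_hd in E as [Nb E]; auto.
  specialize (La _ (hd_in _ N)); specialize (Bb _ (hd_in _ Nb)); lia.
Qed.

Lemma lookup_next n P x l b :
  above n P (x :: l) -> below n P b -> l <> [] -> lookup (stack x) (l ++ b) = lookup (stack x) l.
Proof.
  intros U [BP Bb] N; destruct (U x (or_introl eq_refl)) as (_ & Q & -> & HQ).
  assert (Hl : n <= hd 0 l).
  { destruct l as [|z l]; [congruence|]; apply U; simpl; auto. }
  assert (NP : forall c a, In a P -> prefixb (token a) (l ++ c) = false).
  { intros c a I; apply not_true_is_false; intros E.
    destruct (BP a I) as [Na La]; apply prefixb_hd in E as [_ E]; auto.
    specialize (La _ (hd_in _ Na)); destruct l; [congruence|]; simpl in *; lia. }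
  rewrite !lookup_app_l.
  - apply lookup_ext; intros a I; apply (prefixb_app n); auto; now apply HQ.
  - intros; rewrite <- (app_nil_r l); auto.
  - auto.
Qed.

Lemma lookup_nil h : (forall a, In a h -> token a <> []) -> lookup h [] = null_record.
Proof.
  intros N; destruct (lookup_In h []) as [|[I [D E]]]; auto.
  apply N in I; destruct (token (lookup h [])); [congruence | discriminate].
Qed.

(** Beyond [y], the least element above the cut, the part below each element straddles the cut, so
    it is no token and the scan never restarts; its events are those triggered without [b]. In
    [event_sum] the element [y] counts 0, its actual effect being part of [scan stack (y :: b)]. *)
Lemma scan_upper n P b y u :
  above n P (u ++ [y]) -> below n P b -> b <> [] ->
  scan stack (u ++ y :: b) =
  (fst (scan stack (y :: b)), snd (scan stack (y :: b)) + event_sum stack (u ++ [y])).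
Proof.
  intros U B N; induction u as [|x u IH].
  - simpl app; rewrite surjective_pairing at 1; f_equal.
    change (event_sum stack [y]) with (0 + event (lookup (stack y) [])).
    rewrite lookup_nil; [symmetry; apply Nat.add_0_r|].
    destruct (U y (or_introl eq_refl)) as (_ & Q & -> & HQ).
    intros a I; apply in_app_iff in I as [I | I]; [now apply HQ | now apply B].
  - assert (U' : above n P (u ++ [y])) by (intros z I; apply U; simpl; auto).
    change ((x :: u) ++ y :: b) with (x :: (u ++ y :: b)).
    change ((x :: u) ++ [y]) with (x :: (u ++ [y])) in *.
    assert (El : lookup (stack x) (u ++ y :: b) = lookup (stack x) (u ++ [y])).
    { rewrite <- (lookup_next n P x (u ++ [y]) b); auto.
      - now rewrite <- app_assoc.
      - now destruct u. }
    change (scan stack (x :: (u ++ y :: b))) with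
      (scan_step (stack x) (u ++ y :: b) (scan stack (u ++ y :: b))).
    rewrite IH by auto; unfold scan_step; rewrite El.
    destruct (eqe (token (lookup (stack x) (u ++ [y]))) (u ++ y :: b)) eqn:E.
    + exfalso; apply (proj1 (eqe_spec _ _)) in E.
      destruct (lookup_In (stack x) (u ++ [y])) as [E0 | [_ [D ED]]].
      * rewrite E0 in E; now destruct u.
      * apply (f_equal (@length nat)) in E, ED.
        rewrite !length_app in *; simpl in *.
        destruct b; [congruence | simpl in *; lia].
    + cbn [fst snd event_sum]; f_equal; lia.
Qed.

Lemma wf_below h : wf h -> forall n, stage (hd null_record h) <= n ->
  forall a, In a h -> token a <> [] /\ forall y, In y (token a) -> y < n.
Proof.
  intros W n L a I; destruct (wf_basic _ W a I) as (N & R & _ & _ & T); split; auto.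
  intros y Hy; specialize (R y (or_introl Hy)); lia.
Qed.

Lemma scan_head h y T r :
  lookup h T = r -> token r = T -> stack y = h -> scan stack (y :: T) = (target r, 0).
Proof.
  intros E1 E2 E3; simpl; unfold scan_step; rewrite E3, E1, E2.
  now rewrite (proj2 (eqe_spec T T) eq_refl).
Qed.

(** The point is the value 7 in [wf_more]: the root is a token with target 7, so the scan restarts
    right after it, and the cut at the stage of the top record excludes a later restart. Past stages
    enter because a scan consults the stack at every element. *)
Lemma wf_stack_step s :
  (forall x, x <= s -> wf (stack x) /\ forall r, In r (stack x) -> stage r <= x) ->
  wf (stack (S s)) /\ forall r, In r (stack (S s)) -> stage r <= S s.
Proof.
  intros IH; destruct (IH s (le_n s)) as [W T].
  destruct (stack_cases s) as [-> | (e & X & Le & LX & OK & ->)]; [split; auto|].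
  apply eligible_spec in OK as (L1 & En & NX & R & M); unfold top_record.
  destruct (pop_spec e (stack s)) as (B & EB & HB & Hh).
  set (h := pop e (stack s)) in *.
  assert (Wh : wf h) by (rewrite EB in W; now apply wf_app_r in W).
  assert (Th : forall r, In r h -> stage r <= s).
  { intros r I; apply T; rewrite EB, in_app_iff; auto. }
  assert (Tr : stage (hd null_record h) < S s).
  { destruct h as [|r h']; [apply Nat.lt_0_succ | apply Nat.lt_succ_r, Th; simpl; auto]. }
  split.
  2:{ intros r [<- | I]; [rewrite stage_new_record; lia | specialize (Th _ I); lia]. }
  assert (F : fresh e (bits X)) by (exists X, s; auto).
  assert (R' : forall x, In x (bits X) -> Nat.max e (stage (hd null_record h)) <= x < S s).
  { intros x I; specialize (R x I); apply bits_lt in I; lia. }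
  unfold new_record; destruct (Nat.eqb_spec (prio (hd null_record h)) e) as [Ei | Ei].
  2:{ apply wf_new; auto; destruct Hh as [Eh | Hh]; [rewrite Eh; exact L1 | lia]. }
  destruct (hd_In h) as [h' Eh]; [lia|].
  assert (Ih : In (hd null_record h) h) by (rewrite Eh at 2; simpl; auto).
  destruct (wf_token _ Wh _ Ih) as [Fr _].
  destruct (wf_basic _ Wh _ Ih) as (_ & Br & _).
  rewrite (event_sum_ext (past_stack (history s)) stack).
  2:{ intros x I; apply past_stack_history; apply in_app_iff in I as [I | I].
      - apply bits_lt in I; lia.
      - specialize (Br x (or_intror I)); lia. }
  apply wf_more; auto.
  set (r := hd null_record h) in *.
  (* The elements of [X] lie between [stage r] and [s], and during these stages [persist] keeps [h]
     at the bottom of the stack. *)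
  assert (U : above (stage r) h (bits X)).
  { intros x I; specialize (R' x I); split; [lia|].
    rewrite Eh in EB.
    assert (x < s) by (apply bits_lt in I; lia).
    destruct (persist s B r h' EB) with (x := x) as (A' & EA & HA); [|lia|].
    { intros a Ia; apply HB in Ia; lia. }
    exists A'; rewrite Eh; split; auto; intros a Ia.
    destruct (IH x) as [Wx _]; [lia|]; rewrite EA in Wx.
    split.
    - apply (wf_basic _ Wx a); apply in_app_iff; auto.
    - intros y Hy; apply (wf_above _ _ _ Wx HA a Ia); auto. }
  assert (Bl : below (stage r) h (root r)).
  { split; [intros a Ia; apply wf_below with (h := h); auto|].
    intros x Ix; apply (Br x); auto. }
  destruct (exists_last (fresh_nonempty _ _ F)) as (u & y & Eu); rewrite Eu in U |- *.
  rewrite <- app_assoc; simpl app.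
  rewrite (scan_upper _ _ _ _ _ U Bl (fresh_nonempty _ _ Fr)); cbn [fst].
  destruct (wf_root _ Wh _ Ih) as (r1 & I1 & E1 & M1); fold r in E1.
  rewrite (scan_head (stack y) y (root r) r1); auto.
  rewrite (lookup_first (stage r) h); auto.
  - apply lookup_unique; auto; exists []; now rewrite app_nil_r.
  - intros x Ix; apply U, in_app_iff; auto.
Qed.

Lemma wf_stack_le s : forall x, x <= s -> wf (stack x) /\ forall r, In r (stack x) -> stage r <= x.
Proof.
  induction s as [|s IH]; intros x L.
  - replace x with 0 by lia; split; [constructor | intros r []].
  - destruct (Nat.eq_dec x (S s)) as [-> | N]; [now apply wf_stack_step | apply IH; lia].
Qed.

Lemma wf_stack s : wf (stack s).
Proof. exact (proj1 (wf_stack_le s s (le_n s))). Qed.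

Lemma stage_le s r : In r (stack s) -> stage r <= s.
Proof. exact (proj2 (wf_stack_le s s (le_n s)) r). Qed.

(** * Stability and the escaping union *)

Lemma pop_keep e Q P : (forall r, In r P -> prio r <= e) ->
  exists Q', pop e (Q ++ P) = Q' ++ P /\ forall a, In a Q' -> In a Q.
Proof.
  intros HP; induction Q as [|q Q (Q' & E & I)].
  - exists []; split; auto; simpl; destruct P as [|p P]; auto.
    apply pop_stop, HP; simpl; auto.
  - destruct (Nat.le_gt_cases (prio q) e).
    + exists (q :: Q); split; auto; now apply (pop_stop e q (Q ++ P)).
    + exists Q'; split; [|intros; right; auto].
      simpl; now rewrite pop_skip.
Qed.

Lemma stack_grows l s0 s :
  (forall r, In r (stack s0) -> prio r < l) -> s0 <= s ->
  (forall t e X, s0 <= t < s -> act t e X -> l <= e) ->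
  exists Q, stack s = Q ++ stack s0 /\ forall a, In a Q -> l <= prio a.
Proof.
  intros HP; induction 1 as [|s L IH]; intros HA.
  - exists []; split; auto; intros a [].
  - destruct IH as (Q & E & HQ); [intros t e X Lt A; apply (HA t e X); auto; lia|].
    destruct (stack_cases s) as [E' | (e & X & A)]; [rewrite E'; eauto|].
    assert (Le : l <= e) by (apply (HA s e X); auto; lia).
    destruct A as (_ & _ & _ & ->); rewrite E.
    destruct (pop_keep e Q (stack s0)) as (Q' & -> & I).
    { intros r Ir; apply HP in Ir; lia. }
    eexists (_ :: Q'); split; [reflexivity|].
    intros a [<- | Ia]; [rewrite prio_new_record; auto | auto].
Qed.

(** The records of [stack s0] are permanent. As [s0] is exactly the stage of the top one, all later
    tokens lie at or beyond [s0], by [wf_above]. *)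
Definition stable (l s0 : nat) : Prop :=
  (forall r, In r (stack s0) -> prio r < l) /\ stage (hd null_record (stack s0)) = s0 /\
  forall s e X, s0 <= s -> act s e X -> l <= e.

Lemma stable_above l s0 x : stable l s0 -> s0 <= x ->
  exists Q, stack x = Q ++ stack s0 /\ (forall a, In a Q -> l <= prio a) /\
    forall a, In a Q -> token a <> [] /\ forall y, In y (token a) -> Nat.max l s0 <= y.
Proof.
  intros (HP & HT & HA) L.
  destruct (stack_grows l s0 x) as (Q & E & HQ); auto.
  { intros t e X Lt A; apply (HA t e X); auto; lia. }
  exists Q; split; [|split]; auto; intros a Ia.
  pose proof (wf_stack x) as W; rewrite E in W.
  destruct (wf_basic _ W a) as (N & R & _); [apply in_app_iff; auto|].
  split; auto; intros y Hy.
  specialize (R y (or_introl Hy)); specialize (HQ a Ia) as La; apply Nat.max_lub; [lia|].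
  destruct (stack s0) as [|r h]; [rewrite <- HT; apply Nat.le_0_l|].
  simpl in HT; rewrite <- HT; specialize (HP r (or_introl eq_refl)).
  apply (wf_above _ _ _ W) with (a := a); auto.
  intros b Ib; apply HQ in Ib; lia.
Qed.

Lemma least (P : nat -> Prop) n : P n -> exists m, P m /\ forall k, k < m -> ~ P k.
Proof.
  induction n as [n IH] using lt_wf_ind; intros Pn.
  destruct (classic (exists k, k < n /\ P k)) as [(k & L & Pk) | N]; eauto.
  exists n; split; auto; intros k L Pk; apply N; eauto.
Qed.

(** A requirement that has not started needs a root and seven more tokens; afterwards its current
    target counts the tokens still to come. *)
Definition turns_left (l s : nat) : nat :=
  if prio (hd null_record (stack s)) =? l then target (hd null_record (stack s)) else 8.

(** If requirement [l] never acts again, [s] is already stable for [S l]. Otherwise its first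
    action, at [m], discards what lower priorities have pushed since [s], and [S m] takes the place
    of [s] with fewer turns left. *)
Lemma stable_succ l k : forall s, turns_left l s <= k ->
  (forall r, In r (stack s) -> prio r < S l) -> stage (hd null_record (stack s)) = s ->
  (forall t e X, s <= t -> act t e X -> l <= e) ->
  exists s1, s <= s1 /\ stable (S l) s1.
Proof.
  induction k as [|k IH]; intros s Hk HP HT HA;
    (destruct (classic (exists s' X, s <= s' /\ act s' l X)) as [(s' & stack') | N];
      [|exists s; repeat split; auto; intros t e X L A;
        assert (l <= e) by eauto; assert (e <> l) by (intros ->; eauto); lia]);
    apply (least (fun s' => exists X, s <= s' /\ act s' l X)) in stack' as (m & (X & Lm & A) & Lst);
    (destruct (stack_grows (S l) s m) as (Q & E & HQ); auto;
      [intros t e Y Lt At; assert (l <= e) by (apply (HA t e Y); auto; lia);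
       assert (e <> l) by (intros ->; apply (Lst t); [lia | exists Y; split; auto; lia]); lia|]);
    assert (Hd : stack s = [] \/ prio (hd null_record (stack s)) <= l) by
      (destruct (stack s) as [|r h]; auto; right; apply Nat.lt_succ_r, HP; simpl; auto);
    destruct A as (Le & LX & OK & EH); unfold top_record in EH; rewrite eligible_spec in OK;
    rewrite E in OK, EH;
    rewrite (pop_app l Q (stack s)) in OK, EH by (auto; intros a Ia; apply HQ in Ia; lia);
    destruct OK as (L1 & _ & _ & _ & M).
  - unfold turns_left in Hk; destruct (Nat.eqb_spec (prio (hd null_record (stack s))) l); [|lia].
    specialize (M e); lia.
  - destruct (IH (S m)) as (s1 & L & St).
    + unfold turns_left in *; rewrite EH; cbn [hd]; rewrite prio_new_record, Nat.eqb_refl.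
      unfold new_record; destruct (Nat.eqb_spec (prio (hd null_record (stack s))) l); proj; [|lia].
      specialize (M e); lia.
    + rewrite EH; intros r [<- | I]; [rewrite prio_new_record; lia | auto].
    + rewrite EH; apply stage_new_record.
    + intros t e Y L; apply HA; lia.
    + exists s1; split; auto; lia.
Qed.

Lemma stable_next l s0 : stable l s0 -> exists s1, s0 <= s1 /\ stable (S l) s1.
Proof.
  intros (HP & HT & HA); apply (stable_succ l (turns_left l s0)); auto.
  intros r I; apply HP in I; lia.
Qed.

Lemma stable_ex l : exists s0, stable l s0.
Proof.
  induction l as [|l [s0 St]].
  - exists 0; repeat split; [intros r [] | intros; lia].
  - destruct (stable_next _ _ St) as (s1 & _ & St'); eauto.
Qed.

Definition unbounded (e : nat) : Prop :=
  forall M, exists X s, enumerates e X s = true /\ X <> 0 /\ forall x, In x (bits X) -> M <= x.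

(** Otherwise a set of the family far enough out makes requirement [l] eligible at a late stage;
    then some requirement up to [l] acts, against stability for [S l]. *)
Lemma complete l s1 : 1 <= l -> unbounded l -> stable (S l) s1 ->
  prio (hd null_record (stack s1)) = l /\ target (hd null_record (stack s1)) = 0.
Proof.
  intros L1 Inf St; apply NNPP; intros N.
  destruct (Inf (Nat.max l (stage (hd null_record (stack s1))))) as (X & sX & En & NX & HX).
  (* Late enough for stability, for the enumeration of [X], and for the searches below [s] to reach
     [X] and [l]. *)
  set (s := s1 + sX + X + l + 1).
  destruct (stable_above _ _ s St) as (Q & E & HQ & _); [lia|].
  assert (Hd : stack s1 = [] \/ prio (hd null_record (stack s1)) <= l).
  { destruct St as (HP & _); destruct (stack s1); auto.
    right; apply Nat.lt_succ_r, HP; simpl; auto. }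
  assert (OK : eligible (stack s) s l X = true).
  { apply eligible_spec; rewrite E, (pop_app l Q) by (auto; intros a Ia; apply HQ in Ia; lia).
    repeat split; auto.
    - eapply haltsin_mono; [|exact En]; lia.
    - intros Ei; destruct (target (hd null_record (stack s1))); [exfalso; auto | lia]. }
  destruct (step_spec s) as [[_ F] | (e & Y & A & Min)].
  - rewrite F in OK; [discriminate | lia | lia].
  - assert (S l <= e) by (apply (proj2 (proj2 St) s e Y); auto; lia).
    rewrite Min in OK; [discriminate | lia | lia].
Qed.

Definition pend (v : nat) : Prop := v = 0 \/ v = 1 \/ v = 2 \/ v = 4.

Lemma pend_shift y : y < 7 -> pend (shift y).
Proof. unfold pend; intros L; do 7 (destruct y as [|y]; [cbv; auto|]); lia. Qed.

Lemma pend_lookup h Y : wf h -> pend (event (lookup h Y)).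
Proof.
  intros W; destruct (lookup_In h Y) as [-> | [I _]]; [left; reflexivity|].
  destruct (wf_kind _ W _ I) as [[_ ->] | (_ & _ & ->)]; [left; reflexivity|].
  apply pend_shift, Nat.mod_upper_bound; lia.
Qed.

Lemma mod7_sum a b : a mod 7 = b mod 7 -> exists p q, a + 7 * p = b + 7 * q.
Proof.
  intros E; exists (b / 7), (a / 7).
  pose proof (Nat.div_mod_eq a 7); pose proof (Nat.div_mod_eq b 7); lia.
Qed.

(* [y + shift y] lies in {1, 2, 4} modulo 7, and no sum of an element of {1, 2, 4} and one of
   {0, 1, 2, 4} vanishes modulo 7. *)
Lemma shift_mod7 z v t w : pend v ->
  (z + v + t + shift ((t + w mod 7) mod 7) + w) mod 7 <> z mod 7.
Proof.
  intros V E; apply mod7_sum in E as (p & q & E).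
  rewrite Nat.Div0.add_mod_idemp_r in E.
  pose proof (Nat.div_mod_eq (t + w) 7) as D; pose proof (Nat.mod_upper_bound (t + w) 7) as L.
  set (y := (t + w) mod 7) in *; clearbody y; set (d := (t + w) / 7) in *; clearbody d.
  assert (y = 0 \/ y = 1 \/ y = 2 \/ y = 3 \/ y = 4 \/ y = 5 \/ y = 6) as C by lia.
  unfold pend in V.
  destruct C as [->|[->|[->|[->|[->|[->| ->]]]]]]; unfold shift in E; simpl nth in E; lia.
Qed.

Lemma bits_funion_before B T : before B T -> bits (funion B T) = bits T ++ bits B.
Proof.
  intros (_ & _ & L); apply bits_lor; intros x y Hx Hy.
  apply L; now apply in_bits.
Qed.

Lemma coloring_false n :
  coloring n = false <-> fst (scan stack (bits n)) = snd (scan stack (bits n)) mod 7.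
Proof. unfold coloring; rewrite negb_false_iff; apply Nat.eqb_eq. Qed.

(** A token consists of one or two sets of its family; adding [X''] therefore gives a finite union
    of members. *)
Lemma token_sets e r h n (W : wf h) (I : In r h) (Er : prio r = e) X'' :
  (forall x, In x (token r) -> x < n) -> (forall x, In x (bits X'') -> n <= x) ->
  (exists s, enumerates e X'' s = true) ->
  exists Xs, (forall X, In X Xs -> exists s, enumerates e X s = true) /\
    bits (fold_right funion 0 Xs) = bits X'' ++ token r.
Proof.
  intros Ht HX En; destruct (wf_token _ W r I) as [(X0 & s0 & E0 & _ & En0) K].
  rewrite Er in *.
  destruct K as [K | (t & (X1 & s1 & -> & _ & En1) & K & L)].
  - exists [X0; X'']; split.
    + intros X [<- | [<- | []]]; eauto.
    + rewrite K, E0 in *; simpl; unfold funion; rewrite Nat.lor_0_r; apply bits_lor.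
      intros x y Hx Hy; specialize (Ht x Hx); specialize (HX y Hy); lia.
  - exists [X0; X1; X'']; split.
    + intros X [<- | [<- | [<- | []]]]; eauto.
    + rewrite K, E0 in *; simpl; unfold funion; rewrite Nat.lor_0_r.
      assert (E1 : bits (Nat.lor X1 X'') = bits X'' ++ bits X1).
      { apply bits_lor; intros x y Hx Hy.
        specialize (Ht x (proj2 (in_app_iff _ _ _) (or_introl Hx))); specialize (HX y Hy); lia. }
      rewrite bits_lor, E1, app_assoc; auto.
      intros x y Hx Hy; rewrite E1 in Hy; apply in_app_iff in Hy as [Hy | Hy]; auto.
      specialize (Ht x (proj2 (in_app_iff _ _ _) (or_intror Hx))); specialize (HX y Hy); lia.
Qed.

Lemma stable_upper l s0 u : stable l s0 -> (forall x, In x u -> Nat.max l s0 <= x) ->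
  above (Nat.max l s0) (stack s0) u.
Proof.
  intros St Hu x I; split; auto.
  destruct (stable_above l s0 x St) as (Q & E & _ & HQ); [specialize (Hu x I); lia | eauto].
Qed.

Lemma stable_lower l s0 b : stable l s0 -> (forall x, In x b -> x < Nat.max l s0) ->
  below (Nat.max l s0) (stack s0) b.
Proof.
  intros (_ & HT & _) Hb; split; auto; apply wf_below; [apply wf_stack | lia].
Qed.

Lemma escape l N : 1 <= l -> N <= l -> unbounded l ->
  exists Xs, (forall X, In X Xs -> exists s, enumerates l X s = true) /\
    fold_right funion 0 Xs <> 0 /\ coloring (fold_right funion 0 Xs) = false /\
    forall B, B <> 0 -> (forall i, In i (bits B) -> i < N) -> before B (fold_right funion 0 Xs) ->
      coloring B = false -> coloring (funion B (fold_right funion 0 Xs)) = true.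
Proof.
  intros L1 LN Inf.
  destruct (stable_ex l) as [s0 St0]; destruct (stable_next _ _ St0) as (s1 & L01 & St1).
  destruct (complete l s1 L1 Inf St1) as [Ei Em].
  (* Two cuts are used: [Nat.max l s0] separates [B] from the tokens of requirement [l], and [m]
     separates these from [X'']. *)
  set (m := Nat.max (S l) s1).
  destruct (Inf m) as (X'' & sX & En & NX & HX).
  set (z := event_sum stack (bits X'')).
  (* The token is chosen after [X'']: its target is the event sum of [X''] modulo 7. *)
  destruct (wf_chain _ (wf_stack s1)) with (b := z mod 7) as (r & Ir & Er & Mr).
  { intros E; rewrite E in Ei; simpl in Ei; lia. }
  { pose proof (Nat.mod_upper_bound z 7); lia. }
  rewrite Ei in Er.
  destruct (wf_basic _ (wf_stack s1) r Ir) as (Nr & Rr & _).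
  assert (Tr : stage r <= s1) by now apply stage_le.
  assert (Hr : forall x, In x (token r) -> Nat.max l s0 <= x < m).
  { intros x Hx; split; [|specialize (Rr x (or_introl Hx)); lia].
    destruct (stable_above l s0 s1 St0 L01) as (Q & E & _ & HQ).
    rewrite E in Ir; apply in_app_iff in Ir as [Ir | Ir]; [now apply HQ with (a := r)|].
    apply St0 in Ir; lia. }
  destruct (wf_kind _ (wf_stack s1) r Ir) as [[M7 _] | (_ & _ & Ev)].
  { pose proof (Nat.mod_upper_bound z 7); lia. }
  rewrite Mr in Ev.
  destruct (token_sets l r _ m (wf_stack s1) Ir Er X'') as (Xs & HXs & EX); eauto.
  { intros x Hx; now apply Hr. }
  set (T := fold_right funion 0 Xs) in *.
  pose proof (bits_nonempty _ NX) as NX'.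
  destruct (exists_last NX') as (u & y & Eu).
  destruct (exists_last Nr) as (u' & y' & Eu').
  assert (U : above m (stack s1) (u ++ [y])).
  { rewrite <- Eu; now apply stable_upper. }
  assert (Uy : above m (stack s1) [y]).
  { intros x Hx; apply U, in_app_iff; auto. }
  exists Xs; fold T; clearbody T; split; [|split; [|split]]; auto.
  - intros ->; destruct (bits X''); [congruence | discriminate].
  (* The part below [y] is the token, so the scan restarts with target [z mod 7] and then adds up
     [z]. *)
  - apply coloring_false; rewrite EX, Eu, <- app_assoc; simpl app.
    rewrite (scan_upper m (stack s1)); auto; [|apply stable_lower; auto; apply Hr].
    rewrite (scan_head (stack y) y (token r) r); auto.
    + simpl; now rewrite Mr, <- Eu.
    + rewrite (lookup_first m (stack s1)); auto; [|apply stable_lower; auto; apply Hr].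
      apply lookup_unique; auto using wf_stack; exists []; now rewrite app_nil_r.
  - intros B NB HB Bf CB; apply coloring_false in CB.
    unfold coloring; rewrite bits_funion_before, EX by auto.
    apply bits_nonempty in NB; set (b := bits B) in *; clearbody b.
    assert (Lb : below (Nat.max l s0) (stack s0) b).
    { apply stable_lower; auto; intros x Hx; apply HB in Hx; lia. }
    assert (U' : above (Nat.max l s0) (stack s0) (u' ++ [y'])).
    { rewrite <- Eu'; apply stable_upper; auto; apply Hr. }
    assert (Lb' : below m (stack s1) (token r ++ b)).
    { apply stable_lower; auto; intros x Hx; apply in_app_iff in Hx as [Hx | Hx].
      - now apply Hr.
      - apply HB in Hx; lia. }
    (* As [b] is nonempty, the part below [y] properly extends the token: no restart, and the event
       of [r] is added. *)
    assert (E1 : scan stack (y :: token r ++ b) =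
              (fst (scan stack (token r ++ b)), snd (scan stack (token r ++ b)) + event r)).
    { simpl; unfold scan_step; rewrite (lookup_first m (stack s1)) by auto.
      rewrite (lookup_unique _ r) by (auto using wf_stack; eexists; reflexivity).
      destruct (eqe (token r) (token r ++ b)) eqn:E; auto.
      apply (proj1 (eqe_spec _ _)), (f_equal (@length nat)) in E.
      rewrite length_app in E; destruct b; [congruence | simpl in E; lia]. }
    assert (E2 : scan stack ((bits X'' ++ token r) ++ b) =
              (fst (scan stack (token r ++ b)), snd (scan stack (token r ++ b)) + event r + z)).
    { rewrite Eu, <- !app_assoc; simpl app.
      rewrite (scan_upper m (stack s1)); auto; [|now destruct (token r)].
      rewrite E1, <- Eu; reflexivity. }
    rewrite E2; cbn [fst snd].
    assert (E3 : scan stack (token r ++ b) =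
              (fst (scan stack (y' :: b)), snd (scan stack (y' :: b)) + event_sum stack (token r))).
    { rewrite Eu' at 1; rewrite <- app_assoc; simpl app.
      rewrite (scan_upper (Nat.max l s0) (stack s0)); auto; now rewrite Eu'. }
    rewrite E3; cbn [fst snd].
    assert (E4 : lookup (stack y') b = lookup (stack s0) b).
    { apply (lookup_first (Nat.max l s0)); auto.
      intros x Hx; apply U', in_app_iff; auto. }
    apply negb_true_iff, Nat.eqb_neq.
    simpl scan; unfold scan_step; rewrite E4.
    destruct (eqe (token (lookup (stack s0) b)) b) eqn:E; cbn [fst snd].
    (* Here [B] is itself a token. For a root, the restart sets the unreachable target 7; any other
       token has color 1, against [CB]. *)
    + apply (proj1 (eqe_spec _ _)) in E.
      destruct (lookup_In (stack s0) b) as [E0 | [I0 _]].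
      { rewrite E0 in E; now destruct NB. }
      match goal with |- _ <> ?w mod 7 => pose proof (Nat.mod_upper_bound w 7) end.
      destruct (wf_kind _ (wf_stack s0) _ I0) as [[-> _] | (_ & E7 & _)]; [lia|].
      rewrite E, CB in E7; pose proof (Nat.mod_upper_bound (snd (scan stack b)) 7); lia.
    (* By [CB] the target in force is the event sum of [B] modulo 7, and what is added beyond [B]
       does not vanish modulo 7. *)
    + rewrite CB, Ev; apply not_eq_sym, shift_mod7, pend_lookup, wf_stack.
Qed.

(** Each number lies in at most one [f n], so raising the bound by one excludes at most one more
    index. *)
Lemma far_elements (f : nat -> nat) (fD : forall m n, m <> n -> fdisjoint (f m) (f n)) M :
  exists n0, forall n, n0 <= n -> forall x, In x (bits (f n)) -> M <= x.
Proof.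
  induction M as [|M [n0 IH]]; [exists 0; intros; lia|].
  destruct (classic (exists n, In M (bits (f n)))) as [[n1 I1] | N].
  - exists (n0 + S n1); intros n L x I.
    assert (M <= x) by (apply (IH n); auto; lia).
    enough (x <> M) by lia; intros ->.
    rewrite in_bits in I, I1; specialize (fD n n1).
    unfold fdisjoint in fD; apply (f_equal (fun k => Nat.testbit k M)) in fD; [|lia].
    rewrite Nat.land_spec, I, I1, Nat.bits_0 in fD; discriminate.
  - exists n0; intros n L x I.
    assert (M <= x) by (apply (IH n); auto).
    enough (x <> M) by lia; intros ->; eauto.
Qed.

Theorem theorem3p3 :
  exists c : nat -> bool,
    computable_bool c /\
    forall (Bs : list nat) (S : nat -> Prop),
      c_e S -> inf_pairwise_disjoint S ->
      ~ full_matches_family c Bs (NUset S) /\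
      exists T, NUset S T /\ ~ full_matches c Bs T.
Proof.
  exists coloring; split; [exact (computable_Cmp coloring cmp_coloring)|].
  intros Bs S [p Hp] (f & fS & fN & fD).
  enough (exists T, NUset S T /\ ~ full_matches coloring Bs T) as (T & HT & NT).
  { split; eauto; intros F; apply NT, F, HT. }
  set (N := list_max Bs).
  (* Pairing with the successor of [N] pads the index: it enumerates the same family and is at least
     1 and at least [N]. *)
  set (l := npair (pcode p) (Datatypes.S N)).
  assert (LN : Datatypes.S N <= l) by apply npair_ge_r.
  assert (En : forall X, S X <-> exists s, enumerates l X s = true).
  { intros X; rewrite Hp, halts_iff; unfold enumerates, l; now rewrite fstn_npair. }
  assert (Inf : unbounded l).
  { intros M; destruct (far_elements f fD M) as [n0 Hn].
    (* The code 0 is the empty set, which the injective [f] takes at most once. *)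
    assert (K : exists n, n0 <= n /\ f n <> 0).
    { destruct (Nat.eq_dec (f n0) 0) as [E | E]; [|eauto].
      exists (Datatypes.S n0); split; [lia|]; rewrite <- E; apply fN; lia. }
    destruct K as (n & L & NZ); destruct (proj1 (En (f n)) (fS n)) as [s Es].
    exists (f n), s; eauto. }
  destruct (escape l N) as (Xs & HXs & NT & CT & HB); auto; try lia.
  exists (fold_right funion 0 Xs); split.
  - split; auto; exists Xs; split; auto; intros X I; apply En, HXs, I.
  - intros (B & IB & Bf & E1 & E2).
    rewrite CT in *; rewrite (HB B) in E2; auto; [discriminate | apply Bf |].
    (* [N] bounds the codes in [Bs], and an element is smaller than the code of its set. *)
    intros i Hi; apply bits_lt in Hi.
    pose proof (proj1 (list_max_le Bs N) (le_n _)) as F; rewrite Forall_forall in F.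
    specialize (F B IB); lia.
Qed.
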